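(* Let $a$ be a positive integer and $b$ a non-negative integer with $(a,b)\neq(2,1)$, let $n=2a+b+1$, and let $S_1=\{\sigma_1,\sigma_2,\sigma_3\}$, $S_2=\{\tau_1,\tau_2,\tau_3\}$ be the subsets of $\mathfrak{S}_n$ attached to $\theta_{a,b}$ as defined in the context. Then, as directed graphs, $$\widetilde{\mathrm{puz}}(\theta_{a,b})\cong Y(\mathfrak{S}_n,S_1)\cong Y(\mathfrak{S}_n,S_2).$$ Moreover: (i) If $a+b$ is odd, then each of $S_1$ and $S_2$ generates $\mathfrak{S}_n$, and $\widetilde{\mathrm{puz}}(\theta_{a,b})$ is strongly connected. (ii) If $a\equiv 0\pmod 2$ and $b\equiv 0\pmod 4$, then $\widetilde{\mathrm{puz}}_0(\theta_{a,b})\cong Y(A_n,S_1)\cong Y(A_n,S_2)$, and each of $S_1$ and $S_2$ generates $A_n$. (iii) If $a\equiv 0\pmod 2$ and $b\equiv 2\pmod 4$, then $\widetilde{\mathrm{puz}}_0(\theta_{a,b})\cong X(\mathfrak{S}_n,S_1)\cong X(\mathfrak{S}_n,S_2)$, and each of $S_1$ and $S_2$ generates $\mathfrak{S}_n$. (iv) If $a\equiv 1\pmod 2$ and $b\equiv 1\pmod 4$, then $\widetilde{\mathrm{puz}}_0(\theta_{a,b})\cong Y(A_n,S_1)\cong X(\mathfrak{S}_n,S_2)$, $S_1$ generates $A_n$, and $S_2$ generates $\mathfrak{S}_n$. (v) If $a\equiv 1\pmod 2$ and $b\equiv 3\pmod 4$, then $\widetilde{\mathrm{puz}}_0(\theta_{a,b})\cong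 X(\mathfrak{S}_n,S_1)\cong Y(A_n,S_2)$, $S_1$ generates $\mathfrak{S}_n$, and $S_2$ generates $A_n$.
   Context: Theta graph. For a positive integer $a$ and non-negative integer $b$, put $n=2a+b+1$. The graph $\theta_{a,b}$ is the undirected simple graph with vertex set $V=\{v_0,\dots,v_n\}$ and edges $\{v_i,v_{i+1}\}$ for $i\in\{0,1,\dots,n-1\}\setminus\{2a+1\}$, together with $\{v_0,v_{2a+1}\}$, $\{v_0,v_{2a+2}\}$ and $\{v_{2a+b+1},v_{a+1}\}$; when $b=0$ the last two edges are replaced by the single edge $\{v_0,v_{a+1}\}$. (So it is a cycle $v_0,v_1,\dots,v_{2a+1}$ plus a path joining $v_0$ to $v_{a+1}$ with $b$ interior vertices $v_{2a+2},\dots,v_{2a+b+1}$.) Involutions. $\rho:V\to V$ is given by $\rho(v_i)=v_{(i+a+1)\bmod(2a+2)}$ for $0\le i\le 2a+1$ and $\rho(v_i)=v_{4a+b+3-i}$ for $2a+2\le i\le 2a+b+1$. $\psi:V\to V$ is given by $\psi(v_i)=v_{a+1-i}$ for $0\le i\le a+1$, $\psi(v_i)=v_{3a+3-i}$ for $a+2\le i\le 2a+1$, and $\psi(v_i)=v_{4a+b+3-i}$ for $2a+2\le i\le 2a+b+1$. Generating sets. Permutations are composed as functions (right to left). For a path $p=(w_0,w_1,\dots,w_l)$ in $\theta_{a,b}$ let $\sigma_p=(w_0,w_1)(w_1,w_2)\cdots(w_{l-1},w_l)$, a product of transpositions of $V$. Let $p_1=(v_0,v_1,\dots,v_{a+1})$,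 $p_2=(v_0,v_{2a+2},\dots,v_{2a+b+1},v_{a+1})$ (which is $(v_0,v_{a+1})$ if $b=0$), $p_3=(v_0,v_{2a+1},v_{2a},\dots,v_{a+1})$. The permutations $\sigma_{p_k}\rho$ and $\sigma_{p_k}\psi$ of $V$ fix $v_0$; define $\sigma_k,\tau_k\in\mathfrak{S}_n$ by $\sigma_{p_k}\rho(v_i)=v_{\sigma_k(i)}$ and $\sigma_{p_k}\psi(v_i)=v_{\tau_k(i)}$ for $i=1,\dots,n$, $k=1,2,3$. Put $S_1=\{\sigma_1,\sigma_2,\sigma_3\}$, $S_2=\{\tau_1,\tau_2,\tau_3\}$. Puzzle graph. A position is a bijection $f:V\to\{1,2,\dots,n,0\}$; the vertex $f^{-1}(0)$ is called blank. $\mathrm{puz}(\theta_{a,b})$ is the undirected graph whose vertices are all positions, with $f,g$ joined by an edge iff $g=f\circ(v,w)$ for some adjacent vertices $v,w$ of $\theta_{a,b}$ one of which is blank in $f$. $\mathrm{puz}_0(\theta_{a,b})$ is the connected component of $\mathrm{puz}(\theta_{a,b})$ containing the initial position $f_0$, $f_0(v_i)=i$ for $0\le i\le n$. The path contraction $\widetilde{X}$ of a graph $X$ is obtained by repeatedly removing a vertex of degree two and replacing its two incident edges by a single edge joining its two neighbours, until no vertex of degree two remains. $\widetilde{\mathrm{puz}}(\theta_{a,b})$ and $\widetilde{\mathrm{puz}}_0(\theta_{a,b})$ are the path contractions of $\mathrm{puz}(\theta_{a,b})$ and $\mathrm{puz}_0(\theta_{a,b})$; their vertices are the positions (in $\mathrm{puz}$,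 resp. $\mathrm{puz}_0$) whose blank is at $v_0$ or $v_{a+1}$. They are regarded as bi-directed graphs: each undirected edge $\{f,g\}$ is regarded as two directed edges, from $f$ to $g$ and from $g$ to $f$. Cayley graphs. For a finite group $G$ and subset $S\subset G$ (not necessarily generating), $\mathtt{Cay}(G,S)$ is the directed graph with vertex set $G$ and an edge from $g$ to $h$ iff $h=gk$ for some $k\in S$. Let $C_2=\mathbb{Z}/2\mathbb{Z}=\{0,1\}$, $X(G,S)=\mathtt{Cay}(G,S)$ and $Y(G,S)=\mathtt{Cay}(G\times C_2,S\times\{1\})$. $A_n$ is the alternating group. The symbol $\cong$ denotes isomorphism of directed graphs. *)

(* Defs.v *)
From mathcomp Require Import all_boot all_algebra all_fingroup.
From mathcomp Require Import zify.

Set Implicit Arguments.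
Unset Strict Implicit.
Unset Printing Implicit Defensive.

(* Permutations are composed right to left throughout, whereas the group law
   of {perm T} is left to right: (t * s) x = s (t x). *)
Definition pcomp (T : finType) (s t : {perm T}) : {perm T} := (t * s)%g.

Lemma pcompE (T : finType) (s t : {perm T}) x : pcomp s t x = s (t x).
Proof. by rewrite permM. Qed.

(* A finite directed multigraph inside a finite type: [arcs x y] is the number
   of arcs from x to y, and is only meaningful for x and y in [verts].
   An undirected multigraph is identified with its bi-directed version, in
   which every edge {x, y} counts as one arc from x to y and one arc from y to
   x; thus an undirected loop at x contributes 2 to [arcs x x], and the degree
   of a vertex is its number of outgoing arcs. *)
Record digraph (T : finType) := Digraph {
  verts : {set T};
  arcs : T -> T -> nat
}.

Definition digraph_iso (T U : finType) (G : digraph T) (H : digraph U) : Prop :=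
  exists phi : T -> U,
    [/\ {in verts G &, injective phi},
        phi @: verts G = verts H &
        {in verts G &, forall x y, arcs H (phi x) (phi y) = arcs G x y}].

Definition arc_rel (T : finType) (G : digraph T) : rel T :=
  fun x y => [&& x \in verts G, y \in verts G & 0 < arcs G x y].

Definition strongly_connected (T : finType) (G : digraph T) : Prop :=
  {in verts G &, forall x y, connect (arc_rel G) x y}.

Definition component (T : finType) (G : digraph T) (x : T) : digraph T :=
  Digraph [set y in verts G | connect (arc_rel G) x y] (arcs G).

Definition degree (T : finType) (G : digraph T) (x : T) : nat :=
  \sum_(y in verts G) arcs G x y.

(* The vertices of degree two, except for an isolated vertex with a loop,
   which has no neighbours to be joined. *)
Definition contractible (T : finType) (G : digraph T) : pred T :=
  fun v => [&& v \in verts G, degree G v == 2 & arcs G v v == 0].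

(* If the two edges at v lead to distinct vertices x and y, the number of arcs
   from x to y and from y to x increases by 1 * 1, and the number of loops at x
   by 1 * (1 - 1) = 0; if both lead to x, the new edge is a loop, which is
   2 * (2 - 1) = 2 arcs from x to x. *)
Definition contract_vertex (T : finType) (v : T) (G : digraph T) : digraph T :=
  Digraph (verts G :\ v)
    (fun x y => arcs G x y + arcs G x v * (arcs G v y - (x == y))).

Definition contract_step (T : finType) (G : digraph T) : digraph T :=
  if [pick v | contractible G v] is Some v then contract_vertex v G else G.

(* Every effective step removes a vertex, so that #|verts G| steps suffice;
   see path_contraction_final. *)
Definition path_contraction (T : finType) (G : digraph T) : digraph T :=
  iter #|verts G| (@contract_step T) G.

Lemma path_contraction_final (T : finType) (G : digraph T) (v : T) :
  ~~ contractible (path_contraction G) v.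
Proof.
rewrite /path_contraction; move: {2}#|_| (leqnn #|verts G|) => m.
suff H k H' : #|verts H'| <= k -> ~~ contractible (iter k (@contract_step T) H') v.
  by move=> _; apply: H.
elim: k H' => [|k IHk] H' /= leH.
  rewrite /contractible; move: leH; rewrite leqn0 cards_eq0 => /eqP->.
  by rewrite inE.
rewrite -iterS iterSr.
have [nc | [w cw]] : (forall w, ~~ contractible H' w) \/ exists w, contractible H' w.
- case: (pickP (contractible H')) => [w cw | nc]; first by right; exists w.
  by left=> w; rewrite nc.
- have fixH j : iter j (@contract_step T) H' = H'.
    elim: j => //= j ->; rewrite /contract_step.
    by case: pickP => // w; rewrite (negPf (nc w)).
  by rewrite -iterSr fixH.
- apply: IHk; rewrite /contract_step; case: pickP => [u /andP[uH _] | /(_ w)].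
    by move: leH; rewrite (cardsD1 u) uH.
  by rewrite cw.
Qed.

(* [mul] is the law of the finite group G. *)
Definition Cay (T : finType) (mul : T -> T -> T) (G S : {set T}) : digraph T :=
  Digraph G (fun g h => [exists k in S, h == mul g k] : nat).

Definition pcompC2 (T : finType) (x y : {perm T} * 'Z_2) :
    {perm T} * 'Z_2 :=
  (pcomp x.1 y.1, (x.2 + y.2)%R).

Definition CayX (T : finType) (G S : {set {perm T}}) : digraph {perm T} :=
  Cay (@pcomp T) G S.

Definition CayY (T : finType) (G S : {set {perm T}}) : digraph ({perm T} * 'Z_2)%type :=
  Cay (@pcompC2 T) (setX G [set: 'Z_2]) (setX S ([set 1%R] : {set 'Z_2})).

Definition order_theta (a b : nat) : nat := 2 * a + b + 1.

(* The vertex v_i of the theta graph is i : 'I_n.+1, for n = 2a + b + 1. *)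
Notation vertex a b := 'I_(order_theta a b).+1.

Definition theta_edge (a b i j : nat) : bool :=
  [|| [&& j == i.+1, i < order_theta a b & i != 2 * a + 1],
      (i == 0) && (j == 2 * a + 1) |
      if b == 0 then (i == 0) && (j == a + 1)
      else (i == 0) && (j == 2 * a + 2) || (i == 2 * a + b + 1) && (j == a + 1)].

Definition theta_adj (a b : nat) : rel (vertex a b) :=
  fun v w => theta_edge a b v w || theta_edge a b w v.

Definition rho_fun (a b : nat) (v : vertex a b) : vertex a b :=
  inord (if v <= 2 * a + 1 then (v + a + 1) %% (2 * a + 2)
         else 4 * a + b + 3 - v).

Definition psi_fun (a b : nat) (v : vertex a b) : vertex a b :=
  inord (if v <= a + 1 then a + 1 - v
         else if v <= 2 * a + 1 then 3 * a + 3 - v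
         else 4 * a + b + 3 - v).

Lemma val_rho_fun a b (v : vertex a b) :
  rho_fun v = (if v <= a then v + a + 1
               else if v <= 2 * a + 1 then v - (a + 1)
               else 4 * a + b + 3 - v) :> nat.
Proof.
have nE : order_theta a b = 2 * a + b + 1 by [].
have lev := ltn_ord v; rewrite /rho_fun.
case: (leqP v (2 * a + 1)) => [le_v|lt_v].
  have [le_va|lt_av] := leqP v a.
    by rewrite modn_small ?inordK //; lia.
  have -> : v + a + 1 = (v - (a + 1)) + (2 * a + 2) by lia.
  by rewrite modnDr modn_small ?inordK //; lia.
by rewrite inordK; [case: leqP|]; lia.
Qed.

Lemma rho_funK a b : involutive (@rho_fun a b).
Proof.
have nE : order_theta a b = 2 * a + b + 1 by [].
move=> v; apply: val_inj; have := ltn_ord v.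
rewrite [val _]val_rho_fun val_rho_fun /=.
by repeat case: ifP; lia.
Qed.

Lemma val_psi_fun a b (v : vertex a b) :
  psi_fun v = (if v <= a + 1 then a + 1 - v
               else if v <= 2 * a + 1 then 3 * a + 3 - v
               else 4 * a + b + 3 - v) :> nat.
Proof.
have nE : order_theta a b = 2 * a + b + 1 by [].
have lev := ltn_ord v; rewrite /psi_fun.
by rewrite inordK //; repeat case: ifP; lia.
Qed.

Lemma psi_funK a b : involutive (@psi_fun a b).
Proof.
have nE : order_theta a b = 2 * a + b + 1 by [].
move=> v; apply: val_inj; have := ltn_ord v.
rewrite [val _]val_psi_fun val_psi_fun /=.
by repeat case: ifP; lia.
Qed.

Definition rho (a b : nat) : {perm vertex a b} :=
  perm (can_inj (@rho_funK a b)).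

Definition psi (a b : nat) : {perm vertex a b} :=
  perm (can_inj (@psi_funK a b)).

Fixpoint path_perm (T : finType) (p : seq T) : {perm T} :=
  match p with
  | w0 :: ((w1 :: _) as q) => pcomp (tperm w0 w1) (path_perm q)
  | _ => 1%g
  end.

Definition p1 (a b : nat) : seq (vertex a b) :=
  map inord (iota 0 (a + 2)).

Definition p2 (a b : nat) : seq (vertex a b) :=
  map inord (0 :: iota (2 * a + 2) b ++ [:: a + 1]).

Definition p3 (a b : nat) : seq (vertex a b) :=
  map inord (0 :: rev (iota (a + 1) (a + 1))).

(* A permutation of {v_0, .., v_n} fixing v_0, seen as a permutation of
   {1, .., n}; the element i of {1, .., n} is encoded as i - 1 : 'I_n, so that
   [lift ord0] is the inclusion of {1, .., n} into {0, .., n}. *)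
Definition restr0 (n : nat) (s : 'S_n.+1) : 'S_n :=
  odflt 1%g [pick t : 'S_n | [forall i, lift ord0 (t i) == s (lift ord0 i)]].

Lemma lift_restr0 n (s : 'S_n.+1) : s ord0 = ord0 ->
  forall i, lift ord0 (restr0 s i) = s (lift ord0 i).
Proof.
move=> s0; rewrite /restr0; case: pickP => [t /forallP tP i | no_t].
  exact/eqP.
have liftE i : exists j, s (lift ord0 i) = lift ord0 j.
  case: (unliftP ord0 (s (lift ord0 i))) => [j ->|]; first by exists j.
  by rewrite -{2}s0 => /perm_inj/eqP; rewrite eq_sym (negPf (neq_lift _ _)).
have injf : injective (fun i => odflt i (unlift ord0 (s (lift ord0 i)))).
  move=> i j; case: (liftE i) (liftE j) => i' Ei [j' Ej].
  rewrite Ei Ej !liftK /= => eq_ij; apply: (@lift_inj _ ord0).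
  by apply: (@perm_inj _ s); rewrite Ei Ej eq_ij.
case/negP: (negbT (no_t (perm injf))); apply/forallP=> i.
by rewrite permE; case: (liftE i) => j ->; rewrite liftK.
Qed.

Definition sigma_gen (a b : nat) (p : seq (vertex a b)) : 'S_(order_theta a b) :=
  restr0 (pcomp (path_perm p) (rho a b)).

Definition tau_gen (a b : nat) (p : seq (vertex a b)) : 'S_(order_theta a b) :=
  restr0 (pcomp (path_perm p) (psi a b)).

Lemma path_perm_last (T : finType) (x : T) (p : seq T) :
  uniq (x :: p) -> path_perm (x :: p) (last x p) = x.
Proof.
elim: p x => [|y p IHp] x; first by rewrite perm1.
move=> /andP[_ uyp]; have := IHp y uyp.
by rewrite pcompE => /= ->; rewrite tpermR.
Qed.

Lemma path_perm_end a b (s : seq nat) :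
  uniq (0 :: s) -> all (leq^~ (order_theta a b)) s -> last 0 s = a + 1 ->
  path_perm (map inord (0 :: s) : seq (vertex a b)) (inord (a + 1)) = ord0.
Proof.
move=> us als las; have le0s : all (leq^~ (order_theta a b)) (0 :: s) by [].
rewrite -las -(last_map (inord : nat -> vertex a b)) path_perm_last.
  by apply: val_inj; rewrite /= inordK.
rewrite -[_ :: _]/(map inord (0 :: s)) map_inj_in_uniq // => i j.
move=> /(allP le0s)/= lei /(allP le0s)/= lej eq_ij.
by rewrite -(@inordK (order_theta a b) i) // eq_ij inordK.
Qed.

Lemma path_perms_end a b p : p \in [:: p1 a b; p2 a b; p3 a b] ->
  path_perm p (inord (a + 1)) = ord0.
Proof.
rewrite !inE => /or3P[]/eqP->.
- rewrite /p1 addn2 -[iota 0 _]/(0 :: iota 1 a.+1).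
  apply: path_perm_end; first exact: (iota_uniq 0 a.+2).
    by apply/allP=> i; rewrite mem_iota /order_theta; lia.
  by rewrite (last_nth 0) size_iota -[0 :: _]/(iota 0 a.+2) nth_iota ?addn1.
- apply: path_perm_end; last by rewrite last_cat.
    rewrite /= cat_uniq iota_uniq /= mem_cat !mem_iota inE orbF andbT.
    by lia.
  apply/allP=> i; rewrite mem_cat mem_iota inE /order_theta; lia.
- apply: path_perm_end; last first.
  + by rewrite addn1 /= rev_cons last_rcons.
  + by apply/allP=> i; rewrite mem_rev mem_iota /order_theta; lia.
  by rewrite /= rev_uniq iota_uniq mem_rev mem_iota; lia.
Qed.

Lemma sigma_genP a b p : p \in [:: p1 a b; p2 a b; p3 a b] ->
  forall i, lift ord0 (sigma_gen p i) = path_perm p (rho a b (lift ord0 i)).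
Proof.
have nE : order_theta a b = 2 * a + b + 1 by [].
move=> /path_perms_end pE i; rewrite lift_restr0 pcompE //.
rewrite -[RHS]pE; congr (path_perm p _); apply: val_inj.
by rewrite permE [LHS]val_rho_fun [RHS]inordK /= ?nE; lia.
Qed.

Lemma tau_genP a b p : p \in [:: p1 a b; p2 a b; p3 a b] ->
  forall i, lift ord0 (tau_gen p i) = path_perm p (psi a b (lift ord0 i)).
Proof.
have nE : order_theta a b = 2 * a + b + 1 by [].
move=> /path_perms_end pE i; rewrite lift_restr0 pcompE //.
rewrite -[RHS]pE; congr (path_perm p _); apply: val_inj.
by rewrite permE [LHS]val_psi_fun [RHS]inordK /= ?nE; lia.
Qed.

Definition genS1 (a b : nat) : {set 'S_(order_theta a b)} :=
  [set sigma_gen (p1 a b); sigma_gen (p2 a b); sigma_gen (p3 a b)].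

Definition genS2 (a b : nat) : {set 'S_(order_theta a b)} :=
  [set tau_gen (p1 a b); tau_gen (p2 a b); tau_gen (p3 a b)].

(* A position maps the vertex v_i to a label in {0, 1, .., n}; since both sets
   are encoded as 'I_n.+1, positions are permutations. The initial position is
   the identity. *)
Definition puz_adj (a b : nat) : rel {perm vertex a b} :=
  fun f g => [exists v, exists w,
    [&& theta_adj v w, (f v == ord0) || (f w == ord0) & g == pcomp f (tperm v w)]].

Definition puz (a b : nat) : digraph {perm vertex a b} :=
  Digraph [set: {perm vertex a b}] (fun f g => puz_adj f g : nat).

Definition puz0 (a b : nat) : digraph {perm vertex a b} :=
  component (puz a b) 1%g.

(* The subgroup generated by a set of permutations does not depend on the
   order of composition. *)
Definition generates (n : nat) (S G : {set 'S_n}) : Prop := <<S>>%g = G.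

(* Main.v *)
From mathcomp Require Import all_boot all_algebra all_fingroup alt zify.
Require Import Defs.

Set Implicit Arguments.
Unset Strict Implicit.
Unset Printing Implicit Defensive.

(** Path contraction turns every journey of the blank along one of the paths
    p_1, p_2, p_3, between the vertices v_0 and v_{a+1} of degree three, into a
    single edge. So the contracted puzzle graph has as vertices the positions
    with blank at v_0 or v_{a+1}, and a position f with blank at v_0 is joined
    exactly to the positions f sigma_k, where sigma_k is the cycle of p_k
    ([contraction_puz], from the general [path_contraction_chains]).

    Let phi be rho or psi, a symmetry of the theta graph that exchanges v_0 and
    v_{a+1}. Composing with phi when the blank is at v_{a+1}, and recording
    where the blank was, identifies these positions with the pairs in
    S_n x C_2. An edge leaving v_0 becomes right multiplication by
    sigma_k phi. An edge leaving v_{a+1} multiplies by the inverse of some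
    sigma_k; as phi permutes the three paths up to reversal, this inverse is
    phi sigma_l phi for some l ([conj_sig_rho], [conj_sig_psi]), so it too
    becomes right multiplication by a generator ([end_arcsE]). Applied to both
    involutions, this gives the two isomorphisms with the graphs Y.

    For generation, the products of sigma_k and the inverse of sigma_l lie in
    the groups generated by S_1 and by S_2. They rotate the tokens around the
    three loops of the theta graph. The commutator of two such rotations is a
    3-cycle if b = 0 ([linked_chord]) and a double transposition otherwise, and
    then two of its conjugates combine into a 3-cycle ([linked_long],
    [linked_pentagon]); for a = 1 a loop is already a 3-cycle. The relation of lying on a common 3-cycle of the group
    is an equivalence relation invariant under the group, and each loop misses
    the interior of one path, which leaves room for a single class
    ([linked_theta]). Hence the group contains A_n ([Alt_sub_theta]).

    The rest is parity. If a + b is odd, one of the loops is odd and everything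
    is generated. If a + b is even, the theta graph is bipartite, and a
    position with blank at v_0 or v_{a+1} belongs to the component of the
    initial one exactly when its sign is given by the colour of its blank
    ([mem_reach0]). The generators sigma_k phi then all have the same sign,
    computed from [odd_rho], [odd_psi] and [odd_sig_even]. If they are even, the
    component becomes Y(A_n, S); if they are odd, the sign of a permutation
    determines the C_2 component and what remains is X(S_n, S). *)

(** * Groups of permutations containing all 3-cycles *)

Lemma tperm_disjointC (T : finType) (i j k l : T) :
  k != i -> l != i -> k != j -> l != j ->
  (tperm i j * tperm k l = tperm k l * tperm i j)%g.
Proof. by move=> ki li kj lj; rewrite conjgC tpermJ !tpermD. Qed.

Section ThreeCycles.
Variables (T : finType) (G : {group {perm T}}).

Definition cyc3 (i j k : T) : bool := ((tperm i j * tperm j k)%g \in G).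

(** Stated with a witness for the third point because a block argument only
    ever produces some 3-cycle through a given pair; [cyc3_all] then shows
    that the choice of the third point is immaterial. *)
Definition linked (i j : T) : Prop :=
  i = j \/ exists k, [/\ i != j, k != i, k != j & cyc3 i j k].

Lemma cyc3_rev i j k : cyc3 i j k -> cyc3 k j i.
Proof. by rewrite /cyc3 -groupV invMg !tpermV (tpermC k) (tpermC j i). Qed.

Lemma cyc3_rot i j k : i != j -> i != k -> cyc3 i j k -> cyc3 j k i.
Proof.
move=> ij ik; rewrite /cyc3 conjgC tpermJ tpermL tpermD 1?eq_sym //.
by rewrite (tpermC i).
Qed.

Lemma cyc3J g i j k : g \in G -> cyc3 i j k -> cyc3 (g i) (g j) (g k).
Proof. by move=> gG; rewrite /cyc3 -!tpermJ -conjMg memJ_norm // (subsetP (normG G)). Qed.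

Lemma linked_sym i j : linked i j -> linked j i.
Proof.
case=> [->|[k [ij ki kj c]]]; first by left.
right; exists k; split=> //; first by rewrite eq_sym.
by apply: cyc3_rot (cyc3_rev c).
Qed.

Lemma linkedJ g i j : g \in G -> linked i j -> linked (g i) (g j).
Proof.
move=> gG [->|[k [ij ki kj c]]]; first by left.
by right; exists (g k); rewrite !(inj_eq perm_inj); split=> //; apply: cyc3J.
Qed.

(** The form in which invariance is used: a cycle that fixes one of two linked
    points links that point to the whole orbit of the other. *)
Lemma linked_fix g i j : g \in G -> g i = i -> linked i j -> linked i (g j).
Proof. by move=> gG gi /(linkedJ gG); rewrite gi. Qed.

(** Conjugating a 3-cycle through i and j by one through j and l that fixes i
    moves j to l. *)
Lemma linked_trans i j l : linked i j -> linked j l -> linked i l.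
Proof.
case=> [->//|[k [ij ki kj c]]] [<-|[m [jl mj ml d]]].
  by right; exists k.
have [->|il] := eqVneq i l; first by left.
have [mi|mi] := eqVneq m i.
  apply: linked_sym; right; exists j; rewrite (eq_sym l) il jl (eq_sym j) ij.
  split=> //.
  by move: d; rewrite mi; apply: cyc3_rot; rewrite // eq_sym.
pose g := (tperm l m * tperm j l)%g.
have gG : g \in G by rewrite -groupV invMg !tpermV.
have gi : g i = i by rewrite permM !tpermD // eq_sym.
have gj : g j = l by rewrite permM (tpermD _ mj) ?tpermL // eq_sym.
by rewrite -gi -gj; apply: linkedJ => //; right; exists k.
Qed.

(** From 3-cycles (i j k) and (k l m), conjugation by a power of the second one
    that sends k to l turns the first into (i j l). When m is i or j, so that
    the conjugation moves i or j as well, the other nontrivial power gives a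
    3-cycle on the same three points. *)
Lemma cyc3_all : (forall i j, linked i j) ->
  forall i j l, i != j -> j != l -> i != l -> cyc3 i j l.
Proof.
move=> lk i j l ij jl il.
have [eq_ij|[k [_ ki kj c]]] := lk i j; first by rewrite eq_ij eqxx in ij.
have [eq_kl|[m [kl mk ml d]]] := lk k l; first by rewrite -eq_kl.
pose g := (tperm k l * tperm l m)%g.
have gG : g \in G by [].
have [km lm lk'] : [/\ k != m, l != m & l != k] by rewrite !(eq_sym _ m) !(eq_sym l).
have gk : g k = m by rewrite permM !tpermL.
have gl : g l = k by rewrite permM tpermR tpermD // eq_sym.
have gm : g m = l by rewrite permM (tpermD km lm) tpermR.
have gD u : k != u -> l != u -> m != u -> g u = u.
  by move=> uk ul um; rewrite permM (tpermD uk ul) tpermD.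
have [mi|mi] := eqVneq m i.
  by subst i; have := cyc3J gG c; rewrite gk gm gD // 1?eq_sym //; apply: cyc3_rev.
have [mj|mj] := eqVneq m j.
  subst j; have := cyc3J gG c; rewrite gk gm gD // 1?eq_sym //.
  by move/(cyc3_rot il ij); apply: cyc3_rev.
have := cyc3J (groupVr gG) c.
have gVD u : k != u -> l != u -> m != u -> (g^-1)%g u = u.
  by move=> uk ul um; rewrite -{1}(gD u) // permK.
have gVk : (g^-1)%g k = l by rewrite -gl permK.
by rewrite gVk !gVD // eq_sym.
Qed.

Lemma tperm_mul_in i j l : (forall i j, linked i j) -> i != j -> j != l ->
  (tperm i j * tperm j l)%g \in G.
Proof.
move=> lk ij jl; have [<-|il] := eqVneq i l; last exact: cyc3_all.
by rewrite (tpermC j) tperm2.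
Qed.

(** An even permutation is a product of pairs of transpositions, and a pair
    (i j)(k l) is the product of (i j)(j k) and (j k)(k l). *)
Theorem Alt_sub_linked : (forall i j, linked i j) -> ('Alt_T)%g \subset G.
Proof.
move=> lk; apply/subsetP=> u; rewrite Alt_even.
have [ts -> dts] := prod_tpermP u; rewrite odd_perm_prod //.
have [m] := ubnP (size ts); elim: m ts dts => // m IHm [|[i j] [|[k l] ts]] //=.
  by rewrite big_nil group1.
case/and3P=> /= ij kl dts lt_ts; rewrite negbK !big_cons mulgA => ev.
apply: groupM; last by apply: IHm => //; apply: leq_trans (leqnSn _) _.
rewrite /=; have [jk|jk] := eqVneq j k; first by subst k; apply: tperm_mul_in.
have -> : (tperm i j * tperm k l = tperm i j * tperm j k * (tperm j k * tperm k l))%g.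
  by rewrite -!mulgA (mulgA (tperm j k)) tperm2 mul1g.
by rewrite groupM ?tperm_mul_in.
Qed.
End ThreeCycles.

(** * The alternating group inside the group of a theta graph *)

(** Splits on the innermost conditions first and discards contradictory branches
    at once, so that nested tests do not multiply. *)
Ltac decide_ifs :=
  repeat match goal with
  | |- context [if ?c then _ else _] => lazymatch c with
      | context [if _ then _ else _] => fail
      | _ => case: (boolP c) => ?; try (exfalso; lia) end
  end; try lia.

Definition swap_nat (i j k : nat) : nat :=
  if k == i then j else if k == j then i else k.

Lemma val_tperm n (i j k : 'I_n) : tperm i j k = swap_nat i j k :> nat.
Proof.
rewrite /swap_nat.
by case: tpermP => [->|->|/val_eqP/negbTE-> /val_eqP/negbTE->] //; rewrite eqxx //; case: eqP.
Qed.

(** The three loops of the theta graph, as permutations of the vertices other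
    than v_0, with v_i encoded as i - 1: 0, .., a - 1 are the interior of p_1, a
    is v_{a+1}, a + 1, .., 2a are the interior of p_3 in backward order, and the
    interior of p_2 comes last. Pushing the blank along p_k and back along p_l
    rotates the tokens on the loop made of p_k and p_l; [loop13],
    [loop12] and [loop32] are these rotations, and [loop32] also covers the case
    b = 0, where a is sent to 2a + b = 2a. *)
Definition loop13 (a i : nat) : nat :=
  if i < 2 * a then i.+1 else if i == 2 * a then 0 else i.
Definition loop12 (a b i : nat) : nat :=
  if i < a then i.+1 else if i == a then (if b == 0 then 0 else 2 * a + b)
  else if i <= 2 * a then i else if i == 2 * a + 1 then 0 else i.-1.
Definition loop32 (a b i : nat) : nat :=
  if i < a then i else if i == a then 2 * a + b else i.-1.

(** Two cycles sharing a run of at least two consecutive points have a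
    commutator that exchanges only the points next to the ends of that run; here
    it is (a a+1)(0 2a+1). Writing it as y c x = x y avoids inverse functions. *)
Lemma loop_commutator a b i : 0 < a -> 0 < b -> i < 2 * a + b + 1 ->
  loop12 a b (swap_nat 0 (2 * a + 1) (swap_nat a a.+1 (loop13 a i)))
    = loop13 a (loop12 a b i).
Proof.
move=> a0 b0 lt_i; rewrite /loop13 /loop12 /swap_nat; decide_ifs.
Qed.

(** Without interior points on p_2, the neighbour 2a+1 of
    the point 0 in [loop_commutator] gives way to a, and the two transpositions
    merge into a 3-cycle. *)
Lemma loop_commutator0 a i : 0 < a -> i < 2 * a + 1 ->
  loop12 a 0 (swap_nat a 0 (swap_nat a.+1 a (loop13 a i)))
    = loop13 a (loop12 a 0 i).
Proof.
move=> a0 lt_i; rewrite /loop13 /loop12 /swap_nat; decide_ifs.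
Qed.

Section ThetaAlt.
Variables (a b n : nat) (G : {group 'S_n}) (x y z : 'S_n).
Hypotheses (ha : 0 < a) (nE : n = 2 * a + b + 1).
Hypotheses (xG : x \in G) (yG : y \in G) (zG : z \in G).
Hypothesis xE : forall i, x i = loop13 a i :> nat.
Hypothesis yE : forall i, y i = loop12 a b i :> nat.
Hypothesis zE : forall i, z i = loop32 a b i :> nat.

Lemma pointE k : k < 2 * a + b + 1 -> exists i : 'I_n, i = k :> nat.
Proof. by rewrite -nE => lt_k; exists (Ordinal lt_k). Qed.

(** The block argument. The loop 32 fixes o, the first interior point of p_1,
    and its orbit of d contains everything outside the interior of p_1; the loop
    12 then fixes the point 2a, which is linked to o, and sweeps that interior.
    A single 3-cycle through o and a point d outside the interior of p_1 is
    therefore enough. *)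
Lemma linked_theta (o d : 'I_n) : o = 0 :> nat -> a <= d -> linked G o d ->
  forall i j, linked G i j.
Proof.
move=> oE le_ad lk_d.
have zo : z o = o by apply: val_inj; rewrite /= zE oE /loop32 ha.
have down m : forall i j : 'I_n, a <= j -> j <= i -> i - j = m ->
    linked G o i -> linked G o j.
  elim: m => [|m IHm] i j aj ji ijm li.
    by rewrite (_ : j = i) //; apply: val_inj => /=; lia.
  apply: (IHm (z i)); rewrite ?zE /loop32; try decide_ifs.
  exact: linked_fix.
have [|e eE] := @pointE a; first by lia.
have le : linked G o e by apply: (down _ d) => //; rewrite eE.
have lz : linked G o (z e) by apply: linked_fix.
have lge (j : 'I_n) : a <= j -> linked G o j.
  move=> aj; apply: (down _ (z e)) (lz) => //; have := ltn_ord j.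
  by rewrite zE eE /loop32 ltnn eqxx; lia.
have [|l lE] := @pointE (2 * a); first by lia.
have yl : y l = l.
  by apply: val_inj; rewrite /= yE lE /loop12; decide_ifs.
have llo : linked G l o by apply/linked_sym/lge; rewrite lE; lia.
have up m : forall i : 'I_n, i <= a -> i = m :> nat -> linked G l i.
  elim: m => [|m IHm] i ia im.
    by rewrite (_ : i = o) //; apply: val_inj; rewrite /= im oE.
  have [|k kE] := @pointE m; first by lia.
  have -> : i = y k.
    by apply: val_inj; rewrite /= yE kE /loop12; decide_ifs.
  by apply: linked_fix => //; apply: IHm => //; lia.
have lall i : linked G o i.
  have [ai|ia] := leqP a i; first exact: lge.
  by apply: linked_trans (linked_sym llo) (up _ _ (ltnW ia) erefl).
by move=> i j; apply: linked_trans (linked_sym (lall i)) (lall j).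
Qed.

Lemma commutator_in (c : 'S_n) : (forall i, y (c (x i)) = x (y i)) -> c \in G.
Proof.
move=> cE; have -> : c = (x^-1 * (y * x) * y^-1)%g.
  apply: (mulIg y); rewrite mulgKV; apply: (mulgI x); rewrite mulKVg.
  by apply/permP=> i; rewrite !permM cE.
by rewrite !groupM ?groupV.
Qed.

Lemma linked_chord : b = 0 -> forall i j, linked G i j.
Proof.
move=> b0; have [|o oE] := @pointE 0; first by lia.
have [|e eE] := @pointE a; first by lia.
have [|f fE] := @pointE a.+1; first by lia.
apply: (@linked_theta o e); rewrite ?eE //.
right; exists f; rewrite -!val_eqE /= oE eE fE; split; try by lia.
apply: cyc3_rev; apply: commutator_in => i; apply: val_inj.
rewrite /= yE permM !val_tperm xE [RHS]xE yE oE eE fE b0.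
by apply: loop_commutator0; have := ltn_ord i; lia.
Qed.

(** The outer loop is itself a 3-cycle. *)
Lemma linked_triangle : a = 1 -> forall i j, linked G i j.
Proof.
move=> a1; have [|o oE] := @pointE 0; first by lia.
have [|e eE] := @pointE a; first by lia.
have [|f fE] := @pointE a.+1; first by lia.
apply: (@linked_theta o e); rewrite ?eE //.
right; exists f; rewrite -!val_eqE /= oE eE fE; split; try by lia.
apply: cyc3_rev; rewrite /cyc3 (_ : _ * _ = x)%g //; apply/permP=> i.
apply: val_inj; rewrite permM /= !val_tperm xE oE eE fE /swap_nat /loop13.
decide_ifs.
Qed.

(** The double transposition c = (a a+1)(0 2a+1) and its conjugate
    c' = (a+2 a+3)(2 2a+1) by the square of the outer loop share only the point
    2a+1; this needs a > 2 for a + 3 not to wrap around to 0. Since c' is an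
    involution, c c' c c' is c times its conjugate by c', and the transposition
    (a a+1) cancels. *)
Lemma linked_long : 2 < a -> 0 < b -> forall i j, linked G i j.
Proof.
move=> a3 b0; have [|o oE] := @pointE 0; first by lia.
have [|o2 o2E] := @pointE 2; first by lia.
have [|e eE] := @pointE a; first by lia.
have [|f fE] := @pointE a.+1; first by lia.
have [|e2 e2E] := @pointE a.+2; first by lia.
have [|f2 f2E] := @pointE a.+3; first by lia.
have [|q qE] := @pointE (2 * a + 1); first by lia.
pose c := (tperm e f * tperm o q)%g.
have cG : c \in G.
  apply: commutator_in => i; apply: val_inj.
  rewrite /= yE permM !val_tperm xE [RHS]xE yE oE eE fE qE.
  by apply: loop_commutator; have := ltn_ord i; lia.
have xx (i j : 'I_n) : loop13 a (loop13 a i) = j -> (x * x)%g i = j.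
  by move=> ij; apply: val_inj; rewrite permM /= !xE.
have c2G : (tperm e2 f2 * tperm o2 q)%g \in G.
  have <- : (c ^ (x * x))%g = (tperm e2 f2 * tperm o2 q)%g.
    rewrite conjMg !tpermJ; congr (tperm _ _ * tperm _ _)%g; apply: xx;
    rewrite ?oE ?o2E ?eE ?e2E ?fE ?f2E ?qE /loop13; decide_ifs.
  by rewrite groupJ // groupM.
pose c2 := (tperm e2 f2 * tperm o2 q)%g.
have c2E (i j : 'I_n) :
    swap_nat o2 q (swap_nat e2 f2 i) = j -> c2 i = j.
  by move=> ij; apply: val_inj; rewrite permM /= !val_tperm.
have cc2G : (tperm q o * tperm o o2)%g \in G.
  have <- : (c * c ^ c2)%g = (tperm q o * tperm o o2)%g.
    have -> : (c ^ c2)%g = (tperm e f * tperm o o2)%g.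
      rewrite conjMg !tpermJ; congr (tperm _ _ * tperm _ _)%g; apply: c2E;
      rewrite ?oE ?o2E ?eE ?e2E ?fE ?f2E ?qE /swap_nat; decide_ifs.
    rewrite /c tperm_disjointC; first last.
    - by rewrite -val_eqE /= qE fE; lia.
    - by rewrite -val_eqE /= oE fE; lia.
    - by rewrite -val_eqE /= qE eE; lia.
    - by rewrite -val_eqE /= oE eE; lia.
    by rewrite -mulgA (mulgA (tperm e f)) tperm2 mul1g (tpermC o q).
  exact: groupM cG (groupJ cG c2G).
apply: (@linked_theta o q); rewrite ?qE //; first by lia.
right; exists o2; rewrite -!val_eqE /= oE o2E qE; split; try by lia.
by apply: cyc3_rot (cyc3_rev cc2G); rewrite -val_eqE /= ?oE ?o2E ?qE; lia.
Qed.

(** For a = 2 the outer loop is too short for the previous shift. Conjugating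
    c = (2 3)(0 5) by the loop 12 followed by twice the outer loop gives
    (2 3)(0 4+b) instead, which shares a transposition with c. The points 5 and
    4 + b differ only if b > 1, hence the exception (2, 1). *)
Lemma linked_pentagon : a = 2 -> 1 < b -> forall i j, linked G i j.
Proof.
move=> a2 b1; have [|o oE] := @pointE 0; first by lia.
have [|e eE] := @pointE 2; first by lia.
have [|f fE] := @pointE 3; first by lia.
have [|q qE] := @pointE 5; first by lia.
have [|r rE] := @pointE (4 + b); first by lia.
pose c := (tperm e f * tperm o q)%g.
have cG : c \in G.
  apply: commutator_in => i; apply: val_inj.
  rewrite /= yE permM !val_tperm xE [RHS]xE yE oE eE fE qE.
  by have := @loop_commutator a b i; rewrite a2; apply; have := ltn_ord i; lia.
have yxx (i j : 'I_n) : loop13 a (loop13 a (loop12 a b i)) = j -> (y * (x * x))%g i = j.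
  by move=> ij; apply: val_inj; rewrite !permM /= !xE yE.
have c2G : (tperm r o * tperm f e)%g \in G.
  have <- : (c ^ (y * (x * x)))%g = (tperm r o * tperm f e)%g.
    rewrite conjMg !tpermJ; congr (tperm _ _ * tperm _ _)%g; apply: yxx;
    rewrite ?oE ?eE ?fE ?qE ?rE /loop13 /loop12; decide_ifs.
  by rewrite groupJ // !groupM.
apply: (@linked_theta o r); rewrite ?rE //; first by lia.
right; exists q; rewrite -!val_eqE /= oE rE qE; split; try by lia.
apply: cyc3_rot; rewrite -?val_eqE /= ?oE ?rE ?qE; try by lia.
rewrite /cyc3.
have <- : (c * (tperm r o * tperm f e))%g = (tperm q o * tperm o r)%g.
  have ne (i j : 'I_n) : i != j :> nat -> i != j by [].
  rewrite /c (tperm_disjointC (i := e) (j := f) (k := o) (l := q));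
    try by apply: ne; rewrite ?oE ?eE ?fE ?qE; lia.
  rewrite -mulgA (tpermC f e) (tperm_disjointC (i := r) (j := o) (k := e) (l := f));
    try by apply: ne; rewrite ?oE ?eE ?fE ?rE; lia.
  by rewrite (mulgA (tperm e f)) tperm2 mul1g (tpermC o q) (tpermC r o).
exact: groupM cG c2G.
Qed.

(** Wilson's theorem for theta graphs with two paths of equal length. *)
Theorem Alt_sub_theta : (a, b) <> (2, 1) -> ('Alt_('I_n))%g \subset G.
Proof.
move=> hab; apply: Alt_sub_linked.
have [/eqP b0|b0] := posnP b; first by apply: linked_chord; apply/eqP.
have [a1|a1] := eqVneq a 1; first exact: linked_triangle.
have [a2|a2] := eqVneq a 2; last by apply: linked_long => //; lia.
apply: linked_pentagon => //; case: (eqVneq b 1) => [b1|]; last by lia.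
by case: hab; rewrite a2 b1.
Qed.

End ThetaAlt.

(** * Path contraction of a graph made of chains *)

(** The number of arcs from x to y in the path graph with vertices s; the two
    terms are the two orientations of an edge. *)
Fixpoint links (T : eqType) (s : seq T) (x y : T) : nat :=
  match s with
  | u :: ((w :: _) as s') =>
      (x == u) * (y == w) + (x == w) * (y == u) + links s' x y
  | _ => 0
  end.

Arguments links : simpl never.

Section Links.
Variable T : eqType.
Implicit Types (s : seq T) (x y u v w : T).

Lemma links1 u x y : links [:: u] x y = 0. Proof. by []. Qed.

Lemma links2 u w s x y : links [:: u, w & s] x y =
  (x == u) * (y == w) + (x == w) * (y == u) + links (w :: s) x y.
Proof. by []. Qed.

Lemma links_cat s1 u s2 x y :
  links (s1 ++ u :: s2) x y = links (rcons s1 u) x y + links (u :: s2) x y.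
Proof.
elim: s1 => [|w s1 IHs] //=.
case: s1 IHs => [_|v s1 IHs] /=; first by rewrite !links2 links1 addn0.
by rewrite !links2 IHs addnA.
Qed.

Lemma links_notin s x y : x \notin s -> links s x y = 0.
Proof.
elim: s => [|u [|w s] IHs] //=; rewrite inE negb_or => /andP[/negbTE xu nx].
rewrite links2 IHs // xu.
by move: nx; rewrite inE negb_or => /andP[/negbTE-> _].
Qed.

Lemma links_sym s x y : links s x y = links s y x.
Proof.
elim: s => [|u [|w s] IHs] //=; rewrite !links2 IHs.
by congr (_ + _); rewrite addnC; congr (_ + _); rewrite mulnC.
Qed.

Lemma links_loop s x : uniq s -> links s x x = 0.
Proof.
elim: s => [|u [|w s] IHs] // /andP[nu us]; rewrite links2 IHs //.
have: u != w by apply: contraNneq nu => ->; rewrite inE eqxx.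
by case: (x =P u) => [->|_]; [move/negbTE-> | rewrite muln0].
Qed.

(** One contraction step on one chain. The right-hand side is the formula that
    defines the contraction of a vertex. *)
Lemma links_bypass s1 u v w s2 x y : uniq (s1 ++ [:: u, v, w & s2]) ->
  x != v -> y != v ->
  links (s1 ++ [:: u, w & s2]) x y =
    links (s1 ++ [:: u, v, w & s2]) x y
    + links (s1 ++ [:: u, v, w & s2]) x v
      * (links (s1 ++ [:: u, v, w & s2]) v y - (x == y)).
Proof.
move=> us xv yv; rewrite !links_cat !links2.
have [nv nv2 nuw] : [/\ v \notin rcons s1 u, v \notin w :: s2 & u != w].
  move: us; rewrite -cat_rcons cat_uniq => /and3P[_ /hasPn us /andP[-> _]].
  have uv t : t \in [:: v, w & s2] -> t \notin rcons s1 u by move/us.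
  rewrite (uv v) ?mem_head //; split=> //.
  apply: contraNneq (uv w _) => [<-|]; first by rewrite mem_rcons mem_head.
  by rewrite !inE eqxx orbT.
rewrite (links_sym _ x v) !(links_notin _ nv).
rewrite (links_sym (w :: s2) x v) !(links_notin _ nv2) !eqxx (negbTE xv) (negbTE yv).
have [-> ->] : (v == u = false) /\ (v == w = false).
  by move: nv nv2; rewrite mem_rcons !inE !negb_or =>
    /andP[/negbTE-> _] /andP[/negbTE-> _].
move: (links (rcons _ _) _ _) (links (w :: _) _ _) => A B.
have wu : (w == u) = false by rewrite eq_sym; apply/negbTE.
move: nuw; case: (x =P u) => [->|xu]; case: (y =P u) => [->|yu];
  rewrite ?eqxx ?(eq_sym u w); do ?[move/negbTE->];
  (try case: (y =P w) => [->|yw]); (try case: (x =P w) => [->|xw]);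
  rewrite ?eqxx ?(eq_sym w u) ?(eq_sym u w); do ?[move/negbTE->]; rewrite ?wu; lia.
Qed.

Lemma links_rcons s u w x y : links (rcons (rcons s u) w) x y =
  links (rcons s u) x y + links [:: u; w] x y.
Proof. by rewrite -cats1 cat_rcons links_cat. Qed.

Lemma links_rev s x y : links (rev s) x y = links s x y.
Proof.
elim: s => [|u [|w s] IHs] //.
by rewrite 2!rev_cons links_rcons -rev_cons IHs addnC !links2 links1; lia.
Qed.

End Links.

(** An inner vertex of a path has degree two and an end has degree one. *)
Lemma sum_links (T : finType) (R : {set T}) u s x : {subset u :: s <= R} ->
  \sum_(y in R) links (u :: s) x y + (x == u) + (x == last u s)
    = 2 * count_mem x (u :: s).
Proof.
have sum1 w c : w \in R -> \sum_(y in R) c * (y == w) = c.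
  move=> wR; rewrite (bigD1 w) //= eqxx muln1 big1 ?addn0 // => y /andP[_ /negbTE->].
  by rewrite muln0.
elim: s u => [|w s IHs] u sR.
  by rewrite big1 // /= (eq_sym u); lia.
have /IHs {IHs} : {subset w :: s <= R} by move=> y ys; rewrite sR // inE ys orbT.
rewrite (eq_bigr _ (fun y _ => links2 u w s x y)) !big_split /= !sum1; last 2 first.
- by rewrite sR // mem_head.
- by rewrite sR // !inE eqxx orbT.
rewrite (eq_sym w) (eq_sym u); lia.
Qed.

Lemma filter_neq_uniq (T : eqType) (v : T) s1 s2 : uniq (s1 ++ v :: s2) ->
  [seq z <- s1 ++ v :: s2 | z != v] = s1 ++ s2.
Proof.
move=> us; rewrite -rem_filter //.
move: us; rewrite cat_uniq /= negb_or => /and3P[_ /andP[/negbTE nv _] _].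
elim: s1 nv => [|u s1 IHs] /=; first by rewrite eqxx.
by rewrite inE eq_sym => /norP[/negbTE-> /negbTE/IHs->].
Qed.

(** A graph on W whose edges are partitioned into chains c i, indexed by the i
    with D i, that run between vertices satisfying E and are otherwise disjoint.
    [E_deg] says that the vertices in E do not have degree two, so that
    contraction stops exactly at them. *)
Section Contraction.
Variables (T I : finType) (D : pred I) (W : {set T}) (E : pred T).
Variables (c : I -> seq T) (src tgt : I -> T).
Hypothesis c_uniq : forall i, D i -> uniq (c i).
Hypothesis cW : forall i, D i -> {subset c i <= W}.
Hypothesis c_ends : forall i, D i -> exists2 m,
  c i = src i :: rcons m (tgt i) & all (predC E) m.
Hypotheses (srcE : forall i, D i -> E (src i)) (tgtE : forall i, D i -> E (tgt i)).
Hypothesis c_cover : forall x, x \in W -> ~~ E x -> exists2 i, D i & x \in c i.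
Hypothesis c_inj : forall x i j, ~~ E x -> D i -> D j -> x \in c i -> x \in c j -> i = j.
Hypothesis E_deg : forall x, x \in W -> E x ->
  \sum_(i | D i) ((x == src i) + (x == tgt i)) != 2.

(** The invariant of contraction, with R the set of remaining vertices: each
    chain has been shortened to its part in R. This does not depend on the order
    in which vertices are removed. *)
Definition chained (R : {set T}) (G : digraph T) : Prop :=
  [/\ verts G = R, R \subset W, (forall x, x \in W -> E x -> x \in R) &
      {in R &, forall x y, arcs G x y =
         \sum_(i | D i) links [seq z <- c i | z \in R] x y}].

Lemma chain_filter (R : {set T}) i : (forall x, x \in W -> E x -> x \in R) -> D i ->
  exists2 m, [seq z <- c i | z \in R] = src i :: rcons m (tgt i) & all (predC E) m.
Proof.
move=> ER Di; have [m cE mE] := c_ends Di.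
have cR x : x \in c i -> E x -> x \in R by move/(cW Di); apply: ER.
exists [seq z <- m | z \in R].
  rewrite cE /= filter_rcons !cR ?srcE ?tgtE // cE inE ?eqxx //.
  by rewrite mem_rcons mem_head orbT.
by apply/allP=> x; rewrite mem_filter => /andP[_ /(allP mE)].
Qed.

Lemma chained_degree (R : {set T}) G x : chained R G -> x \in R ->
  degree G x + \sum_(i | D i) ((x == src i) + (x == tgt i))
    = 2 * \sum_(i | D i) (x \in c i).
Proof.
case=> GE RW ER arcsE xR.
rewrite /degree GE (eq_bigr _ (fun y yR => arcsE x y xR yR)) exchange_big /=.
rewrite -big_split big_distrr /=; apply: eq_bigr => i Di.
have [m mE _] := chain_filter ER Di.
have uE : uniq (src i :: rcons m (tgt i)) by rewrite -mE filter_uniq ?c_uniq.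
rewrite mE addnA -{2}(last_rcons (src i) m (tgt i)) sum_links; last first.
  by move=> z; rewrite -mE mem_filter => /andP[].
by rewrite count_uniq_mem // -mE mem_filter xR.
Qed.

Lemma chained_contractible (R : {set T}) G x : chained R G ->
  contractible G x = (x \in R) && ~~ E x.
Proof.
move=> chG; have [GE RW ER arcsE] := chG; rewrite /contractible GE.
have [xR|//] := boolP (x \in R); rewrite /=.
have xW := subsetP RW x xR; have degG := chained_degree chG xR.
have [Ex|nEx] := boolP (E x); rewrite /=.
  have eqE : \sum_(i | D i) (x \in c i) =
             \sum_(i | D i) ((x == src i) + (x == tgt i)).
    apply: eq_bigr => i Di; have [m cE mE] := c_ends Di.
    have := c_uniq Di; rewrite cE /= mem_rcons inE negb_or.
    case/andP=> /andP[src_tgt _] _.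
    have /negbTE nxm : x \notin m by apply/negP=> /(allP mE) /=; rewrite Ex.
    rewrite inE mem_rcons inE nxm orbF; case: (x =P src i) => [->|]; last by case: (_ == _).
    by rewrite (negbTE src_tgt).
  apply/negbTE/negP=> /andP[/eqP deg2 _]; move: (E_deg xW Ex) => /eqP; case.
  by rewrite eqE in degG; lia.
have ends0 : \sum_(i | D i) ((x == src i) + (x == tgt i)) = 0.
  rewrite big1 // => i Di.
  have [xs|_] := eqVneq x (src i); first by rewrite xs (srcE Di) in nEx.
  by have [xt|_] := eqVneq x (tgt i); first by rewrite xt (tgtE Di) in nEx.
have [i Di xi] := c_cover xW nEx.
have one : \sum_(j | D j) (x \in c j) = 1.
  rewrite (bigD1 i) //= xi big1 ?addn0 // => j /andP[Dj ij].
  apply/eqP; rewrite eqb0; apply: contraNN ij => xj.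
  by apply/eqP; apply: (c_inj nEx).
rewrite arcsE // big1 => [|j Dj]; last first.
  by rewrite links_loop // filter_uniq ?c_uniq.
by rewrite andbT; apply/eqP; lia.
Qed.

Lemma chained_contract (R : {set T}) G v : chained R G -> v \in R -> ~~ E v ->
  chained (R :\ v) (contract_vertex v G).
Proof.
case=> GE RW ER arcsE vR nEv; have vW := subsetP RW v vR.
have [i Di vi] := c_cover vW nEv.
have vc j : D j -> j != i -> v \notin c j.
  by move=> Dj; apply: contraNN => vj; apply/eqP; apply: (c_inj nEv).
split; first by rewrite /= GE.
- by apply: subset_trans RW; apply: subsetDl.
- move=> x xW Ex; rewrite !inE ER // andbT.
  by apply: contraNneq nEv => <-.
move=> x y; rewrite !inE => /andP[xv xR] /andP[yv yR] /=.
rewrite !arcsE // (bigD1 i Di) [in RHS](bigD1 i Di) /=.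
have fD j : [seq z <- c j | z \in R :\ v] = [seq z <- [seq z <- c j | z \in R] | z != v].
  by rewrite -filter_predI; apply: eq_filter => z; rewrite /= in_setD1.
have other j z : D j && (j != i) -> links [seq z <- c j | z \in R] v z = 0.
  by case/andP=> Dj ji; rewrite links_notin // mem_filter (negbTE (vc j Dj ji)) andbF.
have -> : \sum_(j | D j && (j != i)) links [seq z <- c j | z \in R :\ v] x y
    = \sum_(j | D j && (j != i)) links [seq z <- c j | z \in R] x y.
  apply: eq_bigr => j Dj; rewrite fD (eq_in_filter (a2 := predT)) ?filter_predT // => z.
  rewrite mem_filter => /andP[_ zj]; apply/eqP=> zv.
  by case/andP: Dj => Dj ji; rewrite zv (negbTE (vc j Dj ji)) in zj.
rewrite addnAC; congr (_ + _).
rewrite (bigD1 i Di) [X in _ * (X - _)](bigD1 i Di) /=.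
rewrite !big1 ?addn0; last 2 first.
- by move=> j Dj; rewrite other.
- by move=> j Dj; rewrite links_sym other.
have [m cE mE] := chain_filter ER Di.
have uc : uniq (src i :: rcons m (tgt i)) by rewrite -cE filter_uniq ?c_uniq.
have vm : v \in m.
  have : v \in [seq z <- c i | z \in R] by rewrite mem_filter vR.
  rewrite cE inE mem_rcons inE => /or3P[] // /eqP vE; move: nEv;
  by rewrite vE ?srcE ?tgtE.
rewrite fD cE; move: uc; have [m1 m2] := splitPr vm => uc.
have srcE' : src i :: rcons (m1 ++ v :: m2) (tgt i) =
    belast (src i) m1 ++
      [:: last (src i) m1, v, head (tgt i) m2 & behead (rcons m2 (tgt i))].
  rewrite -[RHS]cat_rcons -lastI /= rcons_cat /=; congr (_ :: _ ++ _ :: _).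
  by case: (m2).
rewrite srcE' in uc *; rewrite -links_bypass //; congr (links _ x y).
by rewrite -!(cat_rcons (last _ _)) filter_neq_uniq // cat_rcons.
Qed.

(** At the end no contractible vertex is left, so only the ends of the chains
    remain, and each chain has become a single edge. *)
Theorem path_contraction_chains G : verts G = W ->
  {in W &, forall x y, arcs G x y = \sum_(i | D i) links (c i) x y} ->
  verts (path_contraction G) = [set x in W | E x] /\
  {in [set x in W | E x] &, forall x y, arcs (path_contraction G) x y =
     \sum_(i | D i) ((x == src i) * (y == tgt i) + (x == tgt i) * (y == src i))}.
Proof.
move=> GE arcsE.
have chG : chained W G.
  split=> // x y xW yW; rewrite arcsE //; apply: eq_bigr => i Di.
  by rewrite (eq_in_filter (a2 := predT)) ?filter_predT // => z /(cW Di).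
have [R chR] : exists R, chained R (path_contraction G).
  rewrite /path_contraction; elim: #|_| => [|k [R chR]] /=; first by exists W.
  rewrite /contract_step; case: pickP => [v|_]; last by exists R.
  rewrite (chained_contractible _ chR) => /andP[vR nEv].
  by exists (R :\ v); apply: chained_contract.
have [RE RW ER arcsR] := chR.
have RWE : R = [set x in W | E x].
  apply/setP=> x; rewrite inE; apply/idP/andP => [xR|[xW Ex]]; last exact: ER.
  split; first exact: subsetP RW x xR.
  have := path_contraction_final G x.
  by rewrite (chained_contractible _ chR) xR /= negbK.
rewrite -RWE; split=> // x y xR yR; rewrite arcsR //; apply: eq_bigr => i Di.
have [m mE mnE] := chain_filter ER Di.
suff m0 : m = [::] by rewrite mE m0 links2 links1 addn0.
case: m mE mnE => // z m mE /= /andP[nEz _].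
have : z \in [seq z <- c i | z \in R] by rewrite mE !inE eqxx orbT.
by rewrite mem_filter RWE inE (negbTE nEz) andbF.
Qed.

End Contraction.

(** * Sliding the blank along a path *)

Lemma sum_eq_op (T : finType) (P : pred T) (z : T) (F : T -> nat) :
  \sum_(f | P f) (z == f) * F f = P z * F z.
Proof.
have [zP|zP] := boolP (P z).
  rewrite (bigD1 z) //= eqxx big1 ?addn0 // => f /andP[_ /negbTE].
  by rewrite eq_sym => ->.
by rewrite big1 // => f Pf; case: eqP zP => [->|//]; rewrite Pf.
Qed.

Section Moves.
Variables (a b : nat).
Implicit Types (f g x y : {perm vertex a b}) (u v w : vertex a b) (q : seq (vertex a b)).

Definition blank f : vertex a b := (f^-1)%g ord0.

Lemma blankE f v : (f v == ord0) = (blank f == v).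
Proof. by rewrite (canF_eq (permK f)) eq_sym. Qed.

Lemma blank_of f v : f v = ord0 -> blank f = v.
Proof. by move/eqP; rewrite blankE => /eqP. Qed.

Lemma at_blank f v : blank f = v -> f v = ord0.
Proof. by move/eqP; rewrite -blankE => /eqP. Qed.

Definition slide u w f : {perm vertex a b} := pcomp f (tperm u w).

Lemma slideK u w : involutive (slide u w).
Proof. by move=> f; rewrite /slide /pcomp mulgA tperm2 mul1g. Qed.

Lemma slide_eq u w f g : (g == slide u w f) = (f == slide w u g).
Proof.
rewrite {2}/slide tpermC -/(slide u w g) -(inj_eq (can_inj (slideK u w))) slideK.
exact: eq_sym.
Qed.

Lemma blank_slide u w f : blank f = u -> blank (slide u w f) = w.
Proof. by move/at_blank=> fu; apply: blank_of; rewrite pcompE tpermR. Qed.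

Lemma blank_slideV u w f : blank (slide u w f) = w -> blank f = u.
Proof. by move/at_blank; rewrite pcompE tpermR => /blank_of. Qed.

Lemma theta_adjC v w : theta_adj v w = theta_adj w v.
Proof. exact: orbC. Qed.

Lemma puz_adjE f g : puz_adj f g =
  theta_adj (blank f) (blank g) && (g == slide (blank f) (blank g) f).
Proof.
apply/existsP/andP => [[v /existsP[w /and3P[vw + /eqP gE]]]|[vw gE]].
  rewrite gE -/(slide v w f) !blankE => /orP[]/eqP fE.
    by rewrite (blank_slide w fE) fE.
  have sC : slide v w f = slide w v f by rewrite /slide tpermC.
  by rewrite sC (blank_slide v fE) fE theta_adjC.
exists (blank f); apply/existsP; exists (blank g).
by rewrite vw gE blankE eqxx.
Qed.

Lemma puz_adj_sym f g : puz_adj f g = puz_adj g f.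
Proof.
by rewrite !puz_adjE theta_adjC slide_eq.
Qed.

Lemma puz_adj_slide u w f : theta_adj u w -> blank f = u -> puz_adj f (slide u w f).
Proof. by move=> uw fu; rewrite puz_adjE (blank_slide w fu) fu uw eqxx. Qed.

(** The successive positions when the blank, at u in f, travels along q. *)
Fixpoint moves f u q : seq {perm vertex a b} :=
  if q is w :: q' then slide u w f :: moves (slide u w f) w q' else [::].

Lemma blank_moves f u q : blank f = u -> map blank (moves f u q) = q.
Proof.
elim: q f u => //= w q IHq f u fu.
by rewrite IHq (blank_slide w fu).
Qed.

Lemma last_moves f u q : last f (moves f u q) = pcomp f (path_perm (u :: q)).
Proof.
elim: q f u => [|w q IHq] f u /=; first by rewrite /pcomp mul1g.
by rewrite IHq /slide /pcomp mulgA.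
Qed.

(** The blank of x tells how far along the path x lies, and undoing the slides
    recovers the starting position. *)
Lemma moves_inj f g u q x : uniq (u :: q) -> blank f = u -> blank g = u ->
  x \in f :: moves f u q -> x \in g :: moves g u q -> f = g.
Proof.
elim: q f g u => [|w q IHq] f g u; first by rewrite !inE => _ _ _ /eqP-> /eqP.
move=> /andP[nu uq] fu gu; rewrite in_cons [in X in _ -> X -> _]in_cons /=.
have nblank h : blank h = u -> h \in slide u w f :: moves (slide u w f) w q -> False.
  move=> hu /(map_f blank); rewrite /= blank_moves ?(blank_slide w fu) //.
  by rewrite hu (negbTE nu).
have nblank' h : blank h = u -> h \in slide u w g :: moves (slide u w g) w q -> False.
  move=> hu /(map_f blank); rewrite /= blank_moves ?(blank_slide w gu) //.
  by rewrite hu (negbTE nu).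
case/predU1P=> [->|xf] /predU1P[xg|xg] //.
- by case: (nblank' f).
- by case: (nblank x); rewrite // xg.
- apply: (can_inj (slideK u w)); apply: (IHq _ _ w) xf xg => //; exact: blank_slide.
Qed.

(** A union of connected components; the whole puzzle graph and the component
    of the initial position are treated together. *)
Variable W : {set {perm vertex a b}}.
Hypothesis W_closed : forall f g, f \in W -> puz_adj f g -> g \in W.

Lemma slideW u w f : theta_adj u w -> blank f = u -> (slide u w f \in W) = (f \in W).
Proof.
move=> uw fu; apply/idP/idP => [sW|fW].
  by apply: W_closed sW _; rewrite puz_adj_sym puz_adj_slide.
by apply: W_closed fW _; rewrite puz_adj_slide.
Qed.

Lemma movesW f u q : path (@theta_adj a b) u q -> blank f = u -> f \in W ->
  {subset f :: moves f u q <= W}.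
Proof.
elim: q f u => [|w q IHq] f u /=; first by move=> _ _ fW x; rewrite inE => /eqP->.
case/andP=> uw pq fu fW x; rewrite in_cons => /predU1P[->//|].
by apply: IHq; rewrite ?slideW ?(blank_slide w fu).
Qed.

Lemma moves_cover x u q : path (@theta_adj a b) u q -> x \in W -> blank x \in u :: q ->
  exists f, [/\ f \in W, blank f = u & x \in f :: moves f u q].
Proof.
elim: q u => [|w q IHq] u /=.
  by rewrite inE => _ xW /eqP xu; exists x; rewrite mem_head.
case/andP=> uw pq xW; rewrite in_cons => /predU1P[xu|xq].
  by exists x; rewrite mem_head.
have [f [fW fw xf]] := IHq w pq xW xq; exists (slide u w f).
have sfu : blank (slide u w f) = u by apply: (@blank_slideV u w); rewrite slideK.
by split=> //=; [rewrite -(slideW uw sfu) slideK | rewrite in_cons slideK xf orbT].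
Qed.

(** Counting the edges contributed by all the chains over one path, whatever
    the starting position: an edge of the puzzle graph determines the edge of
    the theta graph that the blank crosses, and conversely each edge of the path
    can be crossed from every position whose blank is at its origin. *)
Lemma sum_moves u q x y : path (@theta_adj a b) u q -> x \in W -> y \in W ->
  \sum_(f | (f \in W) && (blank f == u)) links (f :: moves f u q) x y =
  links (u :: q) (blank x) (blank y) * (y == slide (blank x) (blank y) x).
Proof.
move=> + xW yW; elim: q u => [|w q IHq] u; first by rewrite big1.
case/andP=> uw pq /=; rewrite links2 mulnDl -IHq //.
under eq_bigr do rewrite links2.
rewrite big_split /=; congr (_ + _); last first.
  rewrite [RHS](reindex_inj (can_inj (slideK u w))) /=; apply: eq_bigl => f.
  apply/andP/andP=> [[fW /eqP fu]|[fW /eqP fw]].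
    by rewrite slideW // (blank_slide w fu).
  by rewrite -(slideW uw (blank_slideV fw)) fW (blank_slideV fw) eqxx.
have pick1 (z : {perm vertex a b}) (F : {perm vertex a b} -> nat) : z \in W ->
    \sum_(f | (f \in W) && (blank f == u)) (z == f) * F f = (blank z == u) * F z.
  by move=> zW; rewrite sum_eq_op zW.
rewrite big_split /= pick1 //; under [X in _ + X]eq_bigr do rewrite mulnC.
rewrite pick1 //.
have key z t : (blank z == u) * (t == slide u w z) =
    (blank z == u) * (blank t == w) * (t == slide (blank z) (blank t) z).
  case: eqP => [zu|//]; rewrite zu !mul1n.
  case: (t =P slide u w z) => [->|tz]; first by rewrite (blank_slide w zu) !eqxx.
  by case: (blank t =P w) => // ->; case: eqP.
rewrite !key mulnDl; congr (_ + _).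
rewrite [(blank x == w) * _]mulnC; congr (_ * _).
by rewrite slide_eq.
Qed.

End Moves.

(** * The three paths of the theta graph *)

Lemma links_iota m l i j : links (iota m l) i j =
  [&& m <= i, j == i.+1 & j < m + l] + [&& m <= j, i == j.+1 & i < m + l].
Proof.
elim: l m => [|[|l] IHl] m; rewrite /= ?links1.
- by rewrite /links; lia.
- by lia.
rewrite links2 -[_ :: _]/(iota m.+1 l.+1) IHl !mulnb; lia.
Qed.

Lemma rcons_iota m l : rcons (iota m l) (m + l) = iota m l.+1.
Proof. by rewrite -addn1 iotaD cats1. Qed.

Section Arms.
Variables (a b : nat).

(** The numbers of the interior vertices of p_1, p_2, p_3, for k = 0, 1, 2, in
    the order in which these paths leave v_0. *)
Definition inner (k : 'I_3) : seq nat :=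
  nth [::] [:: iota 1 a; iota (2 * a + 2) b; rev (iota (a + 2) a)] k.

Definition arm (k : 'I_3) : seq nat := rcons (inner k) (a + 1).

Lemma ord3P (P : 'I_3 -> Prop) :
  P (inord 0) -> P (inord 1) -> P (inord 2) -> forall k, P k.
Proof.
move=> P0 P1 P2 k; have [->//|->//|->//] : [\/ k = inord 0, k = inord 1 | k = inord 2].
case: k => [[|[|[|k]]] lt_k] //; [constructor 1 | constructor 2 | constructor 3];
by apply: val_inj; rewrite /= inordK.
Qed.

Lemma armE : [/\ arm (inord 0) = iota 1 (a + 1),
   arm (inord 1) = rcons (iota (2 * a + 2) b) (a + 1) &
   arm (inord 2) = rev (iota (a + 1) (a + 1))].
Proof.
rewrite /arm /inner !inordK //; split=> //=.
  by rewrite iotaD cats1 addnC.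
by rewrite -rev_cons addn2 addn1.
Qed.

Lemma mem_inner k i : (i \in inner k) =
  nth false [:: 0 < i <= a; 2 * a + 2 <= i < 2 * a + 2 + b; a + 2 <= i < 2 * a + 2] k.
Proof.
rewrite /inner; case: k => [[|[|[|k]]] lt_k] //=; rewrite ?mem_rev mem_iota //; lia.
Qed.

Lemma arm_uniq k : uniq (0 :: arm k).
Proof.
rewrite /= mem_rcons rcons_uniq inE !mem_inner.
have -> /= : uniq (inner k).
  by rewrite /inner; case: k => [[|[|[|k]]] lt_k] //=; rewrite ?rev_uniq iota_uniq.
by case: k => [[|[|[|k]]] lt_k] //=; lia.
Qed.

Lemma arm_bound k i : i \in 0 :: arm k -> i < (order_theta a b).+1.
Proof.
rewrite in_cons mem_rcons in_cons mem_inner /order_theta.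
by case: k => [[|[|[|k]]] lt_k] //=; lia.
Qed.

(** Each edge of the theta graph lies on exactly one of the three paths. *)
Lemma sum_links_arm i j : 0 < a -> i < (order_theta a b).+1 -> j < (order_theta a b).+1 ->
  \sum_(k < 3) links (0 :: arm k) i j = theta_edge a b i j || theta_edge a b j i.
Proof.
have [a0 a1 a2] := armE.
rewrite 3!big_ord_recl big_ord0 addn0.
have -> : lift ord0 (lift ord0 ord0) = inord 2 :> 'I_3 by apply: val_inj; rewrite /= inordK.
have -> : lift ord0 ord0 = inord 1 :> 'I_3 by apply: val_inj; rewrite /= inordK.
have -> : ord0 = inord 0 :> 'I_3 by apply: val_inj; rewrite /= inordK.
rewrite a0 a1 a2 => ha lti ltj.
have -> : links (0 :: iota 1 (a + 1)) i j = links (iota 0 (a + 2)) i j.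
  by rewrite addn1 addn2.
have -> : links (0 :: rev (iota (a + 1) (a + 1))) i j =
    links (iota (a + 1) (a + 1)) i j + links [:: 0; 2 * a + 1] i j.
  rewrite -links_rev rev_cons revK addn1 -[iota _ _]cats0.
  have -> : iota (a.+1) a.+1 = rcons (iota a.+1 a) (2 * a + 1).
    rewrite -addn1 iotaD cats1; congr (rcons _ _); lia.
  by rewrite cats0 links_rcons; congr (_ + _); rewrite !links2 !links1; lia.
have -> : links (0 :: rcons (iota (2 * a + 2) b) (a + 1)) i j =
    links (iota (2 * a + 2) b) i j +
    (if b == 0 then links [:: 0; a + 1] i j
     else links [:: 0; 2 * a + 2] i j + links [:: 2 * a + b + 1; a + 1] i j).
  case: (b) => [|b'] //=; rewrite links2.
  have -> : 2 * a + 2 :: rcons (iota (2 * a + 2).+1 b') (a + 1)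
     = rcons (rcons (iota (2 * a + 2) b') (2 * a + 2 + b')) (a + 1).
    by rewrite rcons_iota.
  rewrite links_rcons rcons_iota -[iota _ _]/(2 * a + 2 :: iota _ b').
  by rewrite !links2 !links1 !mulnb; lia.
have links_edge u w : links [:: u; w] i j =
    ((i == u) && (j == w)) + ((j == u) && (i == w)).
  by rewrite links2 links1 addn0 !mulnb [(i == w) && _]andbC.
rewrite !links_iota !links_edge; move: lti ltj; rewrite /order_theta.
have edgeE u v : u < 2 * a + b + 2 -> v < 2 * a + b + 2 ->
    theta_edge a b u v = [&& 0 <= u, v == u.+1 & v < 0 + (a + 2)] +
      ([&& 2 * a + 2 <= u, v == u.+1 & v < 2 * a + 2 + b] +
       (if b == 0 then ((u == 0) && (v == a + 1) : nat)
        else ((u == 0) && (v == 2 * a + 2)) + ((u == 2 * a + b + 1) && (v == a + 1)))) +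
      ([&& a + 1 <= u, v == u.+1 & v < a + 1 + (a + 1)] + ((u == 0) && (v == 2 * a + 1)))
    :> nat.
  rewrite /theta_edge /order_theta; case: (b =P 0) => [->|b0] ltu ltv.
    case: (v =P u.+1) => [->|nvu]; last by lia.
    by rewrite ?andbT /=; lia.
  case: (v =P u.+1) => [->|nvu]; lia.
have edgeC : ~~ (theta_edge a b i j && theta_edge a b j i).
  by rewrite /theta_edge /order_theta; case: (b =P 0) => [->|b0]; lia.
move=> lti ltj; have -> : theta_edge a b i j || theta_edge a b j i =
    theta_edge a b i j + theta_edge a b j i :> nat.
  by move: edgeC; case: theta_edge; case: theta_edge.
rewrite !edgeE; try lia.
case: (b == 0);
  repeat match goal with |- context [nat_of_bool ?c] => generalize (nat_of_bool c) end;
  lia.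
Qed.

End Arms.

(** * The contracted puzzle graph *)

Lemma links_map (T U : eqType) (f : T -> U) s x y : injective f ->
  links (map f s) (f x) (f y) = links s x y.
Proof.
move=> fI; elim: s => [|u [|w s] IHs] //=.
by rewrite !links2 -IHs !(inj_eq fI).
Qed.

Lemma path_links (T : eqType) (e : rel T) u q :
  (forall x y, 0 < links (u :: q) x y -> e x y) -> path e u q.
Proof.
elim: q u => //= w q IHq u He; rewrite He /=; last by rewrite links2 !eqxx.
apply: IHq => x y xy; apply: He; rewrite links2; lia.
Qed.

Section Paths.
Variables (a b : nat).
Implicit Types (v w : vertex a b) (f g x y : {perm vertex a b}).

Definition hub : vertex a b := inord (a + 1).
Definition varm (k : 'I_3) : seq (vertex a b) := map inord (arm a b k).
Definition vpath k := ord0 :: varm k.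

Lemma vpathE : [/\ p1 a b = vpath (inord 0), p2 a b = vpath (inord 1) &
  p3 a b = vpath (inord 2)].
Proof.
have [a0 a1 a2] := armE a b; have i0 : inord 0 = ord0 :> vertex a b.
  by apply: val_inj; rewrite /= inordK.
rewrite /p1 /p2 /p3 /vpath /varm a0 a1 a2 cats1 -i0 -!map_cons; split=> //.
by rewrite addn1 addn2.
Qed.

Lemma map_val_vpath k : map val (vpath k) = 0 :: arm a b k.
Proof.
rewrite /= -map_comp; congr (_ :: _); rewrite -[RHS]map_id; apply/eq_in_map => i ik.
by rewrite /= inordK // (@arm_bound a b k) // inE ik orbT.
Qed.

Lemma val_hub : hub = a + 1 :> nat.
Proof. by rewrite inordK // /order_theta; lia. Qed.

Lemma hub_neq0 : hub != ord0.
Proof. by rewrite -val_eqE /= val_hub; lia. Qed.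

Lemma vpath_uniq k : uniq (vpath k).
Proof. by rewrite -(map_inj_uniq val_inj) map_val_vpath arm_uniq. Qed.

Lemma mem_vpath k v : (v \in vpath k) = ((v : nat) \in 0 :: arm a b k).
Proof. by rewrite -map_val_vpath (mem_map val_inj). Qed.

Lemma varm_hub k : varm k = rcons (map inord (inner a b k)) hub.
Proof. by rewrite /varm map_rcons. Qed.

Hypothesis ha : 0 < a.

Lemma sum_links_vpath v w : \sum_(k < 3) links (vpath k) v w = theta_adj v w.
Proof.
rewrite -(sum_links_arm ha (ltn_ord v) (ltn_ord w)); apply: eq_bigr => k _.
by rewrite -map_val_vpath; apply/esym/links_map/val_inj.
Qed.

Lemma path_vpath k : path (@theta_adj a b) ord0 (varm k).
Proof.
apply: path_links => v w vw; have := sum_links_vpath v w.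
by rewrite -/(vpath k) in vw; rewrite (bigD1 k) //=; case: theta_adj => //=; lia.
Qed.

Lemma vpath_cover v : exists k, v \in vpath k.
Proof.
have lev : v < (2 * a + b + 1).+1 := ltn_ord v.
have H k : (v : nat) \in inner a b k -> exists k, v \in vpath k.
  by move=> vk; exists k; rewrite mem_vpath inE mem_rcons inE vk !orbT.
have [v0|v0] := eqVneq (v : nat) 0; first by exists ord0; rewrite mem_vpath v0 mem_head.
have [vh|vh] := eqVneq (v : nat) (a + 1).
  by exists ord0; rewrite mem_vpath vh inE mem_rcons mem_head orbT.
have [va|va] := leqP v a.
  by apply: (H (inord 0)); rewrite mem_inner inordK //= va lt0n v0.
have [vb|vb] := leqP (2 * a + 2) v.
  by apply: (H (inord 1)); rewrite mem_inner inordK //= vb; lia.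
by apply: (H (inord 2)); rewrite mem_inner inordK //= vb; lia.
Qed.

Lemma vpath_disjoint k l v : v != ord0 -> v != hub -> v \in vpath k -> v \in vpath l ->
  k = l.
Proof.
rewrite !mem_vpath !inE !mem_rcons !inE !mem_inner -!val_eqE /= val_hub => v0 vh.
move=> vk vl; apply: val_inj => /=; move: vk vl.
by case: k l => [[|[|[|k]]] lt_k] [[|[|[|l]]] lt_l] //=; lia.
Qed.

Definition sig k : {perm vertex a b} := path_perm (vpath k).

Lemma sig_hub k : sig k hub = ord0.
Proof.
by rewrite -[hub](last_rcons ord0 (map inord (inner a b k))) -varm_hub path_perm_last ?vpath_uniq.
Qed.

Lemma blank_sig f k : (blank (pcomp f (sig k)) == hub) = (blank f == ord0).
Proof. by rewrite -!blankE pcompE sig_hub. Qed.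

(** The positions that survive path contraction. *)
Definition is_end f := (blank f == ord0) || (blank f == hub).

Section Closed.
Variable W : {set {perm vertex a b}}.
Hypothesis W_closed : forall f g, f \in W -> puz_adj f g -> g \in W.

Lemma sigW f k : blank f = ord0 -> (pcomp f (sig k) \in W) = (f \in W).
Proof.
move=> f0; rewrite /sig /vpath; have := path_vpath k.
elim: (varm k) (ord0 : vertex a b) f f0 => [|w q IHq] u f fu /=.
  by rewrite /pcomp mul1g.
case/andP=> uw pq.
by rewrite -(slideW W_closed uw fu) -(IHq _ _ (blank_slide w fu)) // /slide /pcomp mulgA.
Qed.

(** The chains of the puzzle graph are the journeys of the blank along p_1, p_2
    or p_3, indexed by the starting position and the path. *)
Lemma contraction_puz :
  let G := path_contraction (Digraph W (fun f g => puz_adj f g : nat)) in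
  verts G = [set f in W | is_end f] /\
  {in [set f in W | is_end f] &, forall x y, arcs G x y =
    \sum_(k < 3) ((blank x == ord0) * (y == pcomp x (sig k))
                  + (blank y == ord0) * (x == pcomp y (sig k)))}.
Proof.
pose D (i : {perm vertex a b} * 'I_3) := (i.1 \in W) && (blank i.1 == ord0).
pose c (i : {perm vertex a b} * 'I_3) := i.1 :: moves i.1 ord0 (varm i.2).
pose tgt (i : {perm vertex a b} * 'I_3) := pcomp i.1 (sig i.2).
have sumD (F : {perm vertex a b} -> 'I_3 -> nat) : \sum_(i | D i) F i.1 i.2 =
    \sum_(k < 3) \sum_(f | (f \in W) && (blank f == ord0)) F f k.
  rewrite exchange_big /= pair_big /=; apply: eq_bigl => i.
  by rewrite /D andbT.
have blank_c i : D i -> map (@blank a b) (c i) = vpath i.2.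
  by case/andP=> _ /eqP i0; rewrite /= blank_moves // i0.
have sum_src x (F : {perm vertex a b} -> 'I_3 -> nat) : x \in W ->
    \sum_(i | D i) (x == i.1) * F i.1 i.2 = \sum_(k < 3) (blank x == ord0) * F x k.
  move=> xW; rewrite (sumD (fun f k => (x == f) * F f k)); apply: eq_bigr => k _.
  by rewrite sum_eq_op xW.
have sum_tgt x (F : {perm vertex a b} -> 'I_3 -> nat) : x \in W ->
    \sum_(i | D i) (x == tgt i) * F i.1 i.2 =
    \sum_(k < 3) (blank x == hub) * F (pcomp x (sig k)^-1)%g k.
  move=> xW; rewrite (sumD (fun f k => (x == pcomp f (sig k)) * F f k)).
  apply: eq_bigr => k _; set z := pcomp x _.
  have zx : pcomp z (sig k) = x by rewrite /z /pcomp mulgA mulgV mul1g.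
  have eqE f : (x == pcomp f (sig k)) = (z == f).
    by rewrite -zx /pcomp (inj_eq (mulgI _)).
  under eq_bigr do rewrite eqE.
  rewrite sum_eq_op -(blank_sig z k) zx.
  case: eqP => [xh|]; last by rewrite andbF.
  rewrite andbT; congr (nat_of_bool _ * _); rewrite -(sigW k) ?zx //.
  by apply/eqP; rewrite -(blank_sig z k) zx xh.
move=> G; suff [GE arcsE] : verts G = [set f in W | is_end f] /\
    {in [set f in W | is_end f] &, forall x y, arcs G x y = \sum_(i | D i)
      ((x == i.1) * (y == tgt i) + (x == tgt i) * (y == i.1))}.
  split=> // x y; rewrite !inE => /andP[xW Ex] /andP[yW Ey].
  rewrite arcsE ?inE ?xW ?yW // big_split [RHS]big_split /=.
  rewrite (sum_src x (fun f k => (y == pcomp f (sig k)) : nat)) //; congr (_ + _).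
  under eq_bigr do rewrite mulnC.
  by rewrite (sum_src y (fun f k => (x == pcomp f (sig k)) : nat)).
rewrite {}/G; apply: (@path_contraction_chains _ _ D W is_end c (fun i => i.1) tgt) => //.
- by move=> i Di; apply: (@map_uniq _ _ (@blank a b)); rewrite blank_c // vpath_uniq.
- by move=> i /andP[iW /eqP i0]; apply: movesW => //; apply: path_vpath.
- move=> i Di; have := blank_c i Di; rewrite /c /tgt -last_moves /vpath varm_hub.
  case/lastP: (moves _ _ _) => [|m t] /=; first by case: (map _ _).
  rewrite last_rcons map_rcons => -[_ /rcons_inj[mE _]]; exists m => //.
  apply/allP=> f fm /=.
  have : blank f \in map inord (inner a b i.2) by rewrite -mE map_f.
  have := vpath_uniq i.2; rewrite /vpath varm_hub /= mem_rcons inE negb_or rcons_uniq.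
  case/andP=> /andP[_ n0] /andP[nh _] fi; rewrite /is_end.
  by apply/norP; split; apply: contraTneq fi => ->.
- by move=> i /andP[_ i0]; rewrite /is_end i0.
- by move=> i /andP[_ i0]; rewrite /is_end blank_sig i0 orbT.
- move=> x xW _; have [k xk] := vpath_cover (blank x).
  have [f [fW f0 xf]] := moves_cover W_closed (path_vpath k) xW xk.
  by exists (f, k); rewrite /D /= ?fW ?f0.
- move=> x [f k] [g l] /norP[x0 xh] Df Dg /= xf xg.
  have blk h m : D (h, m) -> x \in c (h, m) -> blank x \in vpath m.
    by move=> Dh xc; rewrite -(blank_c (h, m)) // map_f.
  have kl : k = l by apply: (vpath_disjoint x0 xh (blk _ _ Df xf) (blk _ _ Dg xg)).
  congr (_, _) => //; subst l.
  case/andP: Df => _ /eqP f0; case/andP: Dg => _ /eqP g0.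
  exact: moves_inj (vpath_uniq k) f0 g0 xf xg.
- move=> x xW Ex; rewrite big_split /=.
  have := sum_src x (fun _ _ => 1) xW; under eq_bigr do rewrite muln1; move=> ->.
  have := sum_tgt x (fun _ _ => 1) xW; under eq_bigr do rewrite muln1; move=> ->.
  rewrite !sum_nat_const !card_ord !muln1.
  by case/orP: Ex => /eqP ->; rewrite ?[ord0 == hub]eq_sym ?(negbTE hub_neq0) eqxx.
- move=> x y xW yW; rewrite /= puz_adjE.
  rewrite (sumD (fun f k => links (f :: moves f ord0 (varm k)) x y)).
  under eq_bigr do rewrite (sum_moves W_closed) ?path_vpath //.
  by rewrite -big_distrl /= sum_links_vpath mulnb.
Qed.

End Closed.
End Paths.

(** * The contracted puzzle graph as a Cayley graph *)

(** An isomorphism is given by a total map between the carriers, so its inverse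
    needs a default value x0 away from the vertices. *)
Lemma digraph_iso_sym (T U : finType) (G : digraph T) (H : digraph U) (x0 : T) :
  digraph_iso G H -> digraph_iso H G.
Proof.
case=> phi [phiI phiE phiA].
pose psi y := odflt x0 [pick x in verts G | phi x == y].
have psiK : {in verts H, forall y, psi y \in verts G /\ phi (psi y) = y}.
  move=> y; rewrite -phiE => /imsetP[x xG ->]; rewrite /psi.
  case: pickP => [z /andP[zG /eqP //]|/(_ x)]; by rewrite xG eqxx.
have psiV : {in verts G, forall x, psi (phi x) = x}.
  move=> x xG; have [|psiG psiE] := psiK (phi x); first by rewrite -phiE imset_f.
  exact: phiI.
exists psi; split.
- by move=> y z /psiK[_ {2}<-] /psiK[_ {2}<-] ->.
- apply/setP=> x; apply/imsetP/idP => [[y /psiK[yG _] ->] //|xG].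
  by exists (phi x); rewrite ?psiV // -phiE imset_f.
- by move=> y z /psiK[yG {2}<-] /psiK[zG {2}<-]; rewrite phiA.
Qed.

Lemma digraph_iso_trans (T U V : finType) (G : digraph T) (H : digraph U) (K : digraph V) :
  digraph_iso G H -> digraph_iso H K -> digraph_iso G K.
Proof.
case=> f [fI fE fA] [g [gI gE gA]].
have fH x : x \in verts G -> f x \in verts H by move=> xG; rewrite -fE imset_f.
exists (g \o f); split.
- by move=> x y xG yG /= /gI/fI; apply; rewrite ?fH.
- by rewrite imset_comp fE.
- by move=> x y xG yG; rewrite /= gA ?fH // fA.
Qed.

Section Restriction.
Variable n : nat.
Implicit Types (f g : 'S_n.+1) (s t : 'S_n).

(** The inverse of [restr0] on the permutations fixing 0. *)
Definition extend0 s : 'S_n.+1 := lift_perm ord0 ord0 s.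

Lemma extend0_0 s : extend0 s ord0 = ord0. Proof. exact: lift_perm_id. Qed.

Lemma restr0K f : f ord0 = ord0 -> extend0 (restr0 f) = f.
Proof.
move=> f0; apply/permP=> i; case: (unliftP ord0 i) => [j|] ->; last by rewrite extend0_0.
by rewrite lift_perm_lift lift_restr0.
Qed.

Lemma extend0_inj : injective extend0.
Proof.
move=> s t st; apply/permP=> i; apply: (@lift_inj _ ord0).
by rewrite -!(lift_perm_lift ord0 ord0) -!/(extend0 _) st.
Qed.

Lemma extend0K s : restr0 (extend0 s) = s.
Proof. by apply: extend0_inj; rewrite restr0K ?extend0_0. Qed.

Lemma extend0M s t : extend0 (pcomp s t) = pcomp (extend0 s) (extend0 t).
Proof. by rewrite /extend0 /pcomp lift_permM. Qed.

Lemma odd_extend0 s : extend0 s = s :> bool.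
Proof. by rewrite odd_lift_perm. Qed.

Lemma odd_restr0 f : f ord0 = ord0 -> restr0 f = f :> bool.
Proof. by move=> f0; rewrite -odd_extend0 restr0K. Qed.

End Restriction.

(** Here phi stands for rho or psi, an involution of the theta graph exchanging
    v_0 and v_{a+1}. By [phi_sig] conjugation by phi reverses the three paths and
    permutes them according to pi. *)
Section Model.
Variables (a b : nat) (ha : 0 < a).
Local Notation n := (order_theta a b).
Variables (phi : {perm vertex a b}) (pi : 'I_3 -> 'I_3).
Hypothesis phiK : (phi * phi)%g = 1%g.
Hypothesis phi0 : phi ord0 = hub a b.
Hypothesis piK : involutive pi.
Hypothesis phi_sig : forall k, pcomp phi (pcomp (sig a b k) phi) = (sig a b (pi k))^-1%g.

Implicit Types (f g : {perm vertex a b}).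

Definition gens : {set 'S_n} := [set restr0 (pcomp (sig a b k) phi) | k : 'I_3].

(** A position whose blank is at v_{a+1} is carried over to one with blank at
    v_0 by phi; the second component remembers where the blank was. *)
Definition recentre f : 'S_n * 'Z_2 :=
  if blank f == ord0 then (restr0 f, 0%R) else (restr0 (pcomp f phi), 1%R).

Lemma phi_hub : phi (hub a b) = ord0.
Proof. by rewrite -phi0 -permM phiK perm1. Qed.

Lemma sig_phi0 k : pcomp (sig a b k) phi ord0 = ord0.
Proof. by rewrite pcompE phi0 sig_hub. Qed.

Lemma blank_phi f : blank f = hub a b -> pcomp f phi ord0 = ord0.
Proof. by rewrite pcompE phi0 => /at_blank. Qed.

Lemma recentre0 f : blank f = ord0 -> recentre f = (restr0 f, 0%R).
Proof. by rewrite /recentre => ->; rewrite eqxx. Qed.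

Lemma recentre1 f : blank f = hub a b -> recentre f = (restr0 (pcomp f phi), 1%R).
Proof. by rewrite /recentre => ->; rewrite (negbTE (hub_neq0 a b)). Qed.

Lemma is_endP f : is_end f -> blank f = ord0 \/ blank f = hub a b.
Proof. by case/orP=> /eqP; [left | right]. Qed.

Lemma recentre_inj f g : is_end f -> is_end g -> recentre f = recentre g -> f = g.
Proof.
move=> /is_endP[f0|fh] /is_endP[g0|gh]; rewrite ?(recentre0 f0) ?(recentre0 g0) ?(recentre1 fh) ?(recentre1 gh) => -[] // /(congr1 (@extend0 _)).
  by rewrite !restr0K //; apply: at_blank.
by rewrite !restr0K ?blank_phi // => /mulgI.
Qed.

Lemma recentre_surj p : exists2 f, is_end f & recentre f = p.
Proof.
case: p => s c; have [->|->] : c = 0%R \/ c = 1%R.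
  by case: c => [[|[|c]] lt_c] //; [left | right]; apply: val_inj.
  have b0 : blank (extend0 s : {perm vertex a b}) = ord0 by apply: blank_of; rewrite extend0_0.
  by exists (extend0 s); [rewrite /is_end b0 | rewrite recentre0 // extend0K].
have bh : blank (pcomp (extend0 s : {perm vertex a b}) phi) = hub a b.
  by apply: blank_of; rewrite pcompE phi_hub extend0_0.
exists (pcomp (extend0 s) phi); first by rewrite /is_end bh eqxx orbT.
by rewrite recentre1 // {1}/pcomp mulgA phiK mul1g extend0K.
Qed.

Hypothesis sig_inj : injective (sig a b).

Lemma mem_gens s : (s \in gens) = [exists k : 'I_3, extend0 s == pcomp (sig a b k) phi].
Proof.
apply/imsetP/existsP => [[k _ ->]|[k /eqP sk]]; exists k; rewrite ?restr0K ?sig_phi0 //.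
by apply: extend0_inj; rewrite restr0K // sig_phi0.
Qed.

Lemma sig_gens k : restr0 (pcomp (sig a b k) phi) \in gens.
Proof. exact: imset_f. Qed.

Lemma sum_exists (F : 'I_3 -> bool) :
  (forall k l, F k -> F l -> k = l) -> \sum_(k < 3) F k = [exists k, F k].
Proof.
move=> F1; case: existsP => [[k Fk]|nF].
  rewrite (bigD1 k) //= Fk big1 // => l lk; apply/eqP; rewrite eqb0.
  by apply: contraNN lk => Fl; apply/eqP/F1.
by rewrite big1 // => k _; apply/eqP; rewrite eqb0; apply/negP=> Fk; apply: nF; exists k.
Qed.

Definition end_arcs f g : nat :=
  \sum_(k < 3) ((blank f == ord0) * (g == pcomp f (sig a b k))
               + (blank g == ord0) * (f == pcomp g (sig a b k))).

(** From v_0 to v_{a+1}, multiplying by sigma_k and recentring is multiplying by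
    the generator sigma_k phi. In the other direction the edge multiplies by
    the inverse of some sigma_k, which by [phi_sig] is phi sigma_{pi k} phi, so
    after recentring it is again a multiplication by a generator. *)
Lemma end_arcsE f g : is_end f -> is_end g ->
  end_arcs f g = [exists s in gens, (recentre g).1 == pcomp (recentre f).1 s]
                 && ((recentre g).2 != (recentre f).2) :> nat.
Proof.
rewrite /end_arcs big_split /= -!big_distrr /=.
have sum1 h h' : \sum_(k < 3) (h == pcomp h' (sig a b k)) =
    [exists k, h == pcomp h' (sig a b k)].
  apply: sum_exists => k l /eqP-> /eqP/esym; rewrite /pcomp => /mulIg.
  by move=> /sig_inj.
rewrite !sum1 => /is_endP[f0|fh] /is_endP[g0|gh].
- rewrite f0 g0 !recentre0 //= andbF ?eqxx ?mul1n.
  have no h h' : blank h = ord0 -> blank h' = ord0 ->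
      [exists k, h == pcomp h' (sig a b k)] = false.
    move=> h0 h0'; apply/existsP=> -[k /eqP hE].
    by have := blank_sig h' k; rewrite -hE h0 h0' eqxx eq_sym (negbTE (hub_neq0 a b)).
  by rewrite !no.
- rewrite f0 gh eqxx (negbTE (hub_neq0 a b)) mul0n mul1n addn0 (recentre0 f0) (recentre1 gh) /= andbT.
  congr nat_of_bool; apply/existsP/existsP=> [[k /eqP gE]|[s /andP[]]].
    exists (restr0 (pcomp (sig a b k) phi)); rewrite sig_gens /=.
    apply/eqP/extend0_inj; rewrite extend0M !restr0K ?sig_phi0 ?blank_phi //; last by apply: at_blank.
    by rewrite gE /pcomp !mulgA.
  rewrite mem_gens => /existsP[k /eqP sk] /eqP/(congr1 (@extend0 _)).
  rewrite extend0M !restr0K ?blank_phi //; last by apply: at_blank.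
  rewrite sk => gE; exists k; apply/eqP/(mulgI phi).
  by rewrite -/(pcomp g phi) gE /pcomp !mulgA.
- rewrite fh g0 eqxx (negbTE (hub_neq0 a b)) mul0n mul1n add0n (recentre0 g0) (recentre1 fh) /= andbT.
  have gens_phi k : pcomp (pcomp f phi) (pcomp (sig a b k) phi) =
      pcomp f (sig a b (pi k))^-1%g.
    by rewrite -phi_sig /pcomp !mulgA.
  have eqE k : (f == pcomp g (sig a b k)) = (g == pcomp f (sig a b k)^-1%g).
    by rewrite /pcomp eq_sym (canF_eq (mulKg _)).
  congr nat_of_bool; apply/existsP/existsP=> [[k]|[s /andP[]]].
    rewrite eqE => /eqP gE; exists (restr0 (pcomp (sig a b (pi k)) phi)).
    rewrite sig_gens /=; apply/eqP/extend0_inj.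
    rewrite extend0M !restr0K ?sig_phi0 ?blank_phi //; last by apply: at_blank.
    by rewrite gens_phi piK.
  rewrite mem_gens => /existsP[k /eqP sk] /eqP/(congr1 (@extend0 _)).
  rewrite extend0M !restr0K ?blank_phi //; last by apply: at_blank.
  by rewrite sk gens_phi => gE; exists (pi k); rewrite eqE gE.
- by rewrite fh gh (negbTE (hub_neq0 a b)) !mul0n !recentre1 //= ?eqxx andbF.
Qed.

Section Iso.
Variable W : {set {perm vertex a b}}.
Hypothesis W_closed : forall f g, f \in W -> puz_adj f g -> g \in W.
Let G := path_contraction (Digraph W (fun f g => puz_adj f g : nat)).

Lemma vertsG : verts G = [set f in W | is_end f].
Proof. by have [] := contraction_puz ha W_closed. Qed.

Lemma arcsG : {in verts G &, forall f g, arcs G f g = end_arcs f g}.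
Proof. by rewrite vertsG; have [] := contraction_puz ha W_closed. Qed.

Lemma iso_CayY (H : {set 'S_n}) :
  (forall f, is_end f -> (f \in W) = ((recentre f).1 \in H)) ->
  digraph_iso G (CayY H gens).
Proof.
move=> WH; exists recentre; split.
- by move=> f g; rewrite vertsG !inE => /andP[_ Ef] /andP[_ Eg]; apply: recentre_inj.
- apply/setP=> p; rewrite vertsG /= inE in_setT andbT.
  apply/imsetP/idP => [[f + ->]|pH]; first by rewrite inE => /andP[fW Ef]; rewrite -WH.
  have [f Ef fp] := recentre_surj p.
  by exists f; rewrite // inE Ef WH // fp pH.
move=> f g fG gG; rewrite arcsG //; move: fG gG.
rewrite vertsG !inE => /andP[_ Ef] /andP[_ Eg]; rewrite end_arcsE //=.
congr nat_of_bool; case: (recentre f) (recentre g) => [s c] [t d] /=.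
apply/existsP/andP => [[[u e]]|[/existsP[u /andP[uS /eqP tE]] cd]].
  rewrite in_setX inE => /andP[/andP[/= uS /eqP->] /eqP[-> ->]].
  split; first by apply/existsP; exists u; rewrite uS eqxx.
  by case: c => [[|[|c]] lt_c].
exists (u, 1%R); rewrite in_setX uS inE eqxx /=; apply/eqP; congr (_, _) => //.
by case: c d cd => [[|[|c]] lt_c] [[|[|d]] lt_d] // _; apply: val_inj.
Qed.

(** With odd generators, multiplication changes sign and second component
    together. If they agree on W, the second component is redundant. *)
Lemma iso_CayX : {in gens, forall s, odd_perm s} ->
  (forall f, is_end f -> (f \in W) = (odd_perm (recentre f).1 == ((recentre f).2 != 0%R))) ->
  digraph_iso G (CayX [set: 'S_n] gens).
Proof.
move=> odd_gens Wodd; exists (fst \o recentre).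
have snd_eq f g : f \in W -> is_end f -> g \in W -> is_end g ->
    ((recentre f).2 == (recentre g).2) = (odd_perm (recentre f).1 == odd_perm (recentre g).1).
  move=> + Ef + Eg; rewrite !Wodd // => /eqP-> /eqP->.
  by case: (recentre f) (recentre g) => [? [[|[|c]] lt_c]] [? [[|[|d]] lt_d]].
split.
- move=> f g; rewrite vertsG !inE => /andP[fW Ef] /andP[gW Eg] /= fg.
  apply: recentre_inj => //; apply/eqP; rewrite -pair_eqE /pair_eq fg eqxx /=.
  by rewrite snd_eq // fg.
- apply/setP=> s; rewrite vertsG inE; apply/imsetP.
  have [f Ef fs] := recentre_surj (s, if odd_perm s then 1%R else 0%R).
  exists f; rewrite ?inE /= ?Ef ?Wodd // fs //=; by case: odd_perm.
move=> f g fG gG; rewrite arcsG //; move: fG gG.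
rewrite vertsG !inE => /andP[fW Ef] /andP[gW Eg]; rewrite end_arcsE //=.
congr nat_of_bool; apply/existsP/andP => [[s /andP[sg /eqP fg]]|[/existsP[s e] _]].
  split; first by apply/existsP; exists s; rewrite sg fg eqxx.
  by rewrite eq_sym snd_eq // fg /pcomp odd_permM (odd_gens _ sg); case: odd_perm.
by exists s.
Qed.

End Iso.
End Model.

(** * The permutations of the three paths *)

Section PathPerm.
Variable T : finType.
Implicit Types (s : seq T) (u w x : T).

Lemma path_perm2 u w s :
  path_perm [:: u, w & s] = pcomp (tperm u w) (path_perm (w :: s)).
Proof. by []. Qed.

Lemma path_perm_cat s1 u s2 : path_perm (s1 ++ u :: s2) =
  pcomp (path_perm (rcons s1 u)) (path_perm (u :: s2)).
Proof.
elim: s1 => [|w s1 IHs]; first exact/esym/mulg1.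
case: s1 IHs => [_|v s1 IHs]; first by rewrite /= /pcomp mul1g.
rewrite -[LHS]/(pcomp (tperm w v) (path_perm ((v :: s1) ++ u :: s2))) IHs.
by rewrite /= /pcomp mulgA.
Qed.

Lemma path_perm_rcons s u w : path_perm (rcons (rcons s u) w) =
  pcomp (path_perm (rcons s u)) (tperm u w).
Proof. by rewrite -cats1 cat_rcons path_perm_cat /= /pcomp mul1g. Qed.

Lemma path_perm_rev s : path_perm (rev s) = ((path_perm s)^-1)%g.
Proof.
elim: s => [|u [|w s] IHs]; rewrite ?invg1 //.
rewrite 2!rev_cons path_perm_rcons -rev_cons IHs tpermC.
by rewrite path_perm2 /pcomp invMg tpermV.
Qed.

Lemma path_perm_map (phi : {perm T}) s : path_perm (map phi s) = (path_perm s ^ phi)%g.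
Proof.
elim: s => [|u [|w s] IHs]; rewrite ?conj1g // !map_cons !path_perm2.
by rewrite -map_cons IHs /pcomp conjMg tpermJ.
Qed.

Lemma odd_path_perm u s : uniq (u :: s) -> path_perm (u :: s) = odd (size s) :> bool.
Proof.
elim: s u => [|w s IHs] u; first by rewrite /= odd_perm1.
rewrite [uniq _]/= inE negb_or => /andP[/andP[uw _] us].
by rewrite path_perm2 /pcomp odd_permM (IHs w us) odd_tperm uw addbT.
Qed.

End PathPerm.

(** The cycle of a path sends each vertex to the next one and the last to the
    first. *)
Lemma val_path_perm_iota N m l (v : 'I_N.+1) : m + l <= N ->
  path_perm (map inord (iota m l.+1)) v =
    (if (m <= v) && (v < m + l) then v.+1 else if v == m + l :> nat then m else v) :> nat.
Proof.
elim: l m => [|l IHl] m ml.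
  by rewrite [map _ _]/= perm1; decide_ifs.
have := IHl m.+1; rewrite -[iota m _]/[:: m, m.+1 & iota m.+2 l].
rewrite -[iota m.+1 _]/[:: m.+1 & iota m.+2 l] !map_cons [path_perm [:: _, _ & _]]/=.
rewrite pcompE val_tperm !inordK; try lia.
move=> ->; last by lia.
rewrite /swap_nat; decide_ifs.
Qed.

Section Values.
Variables (a b : nat).
Implicit Types (v : vertex a b).

Let theta_lt k : k <= 2 * a + b + 1 -> k < (order_theta a b).+1.
Proof. by []. Qed.

Let theta_le k : k <= 2 * a + b + 1 -> k <= order_theta a b.
Proof. by []. Qed.

Lemma val_sig0 v : sig a b (inord 0) v =
  (if v <= a then v.+1 else if v == a + 1 :> nat then 0 else v) :> nat.
Proof.
have [a0 _ _] := armE a b; rewrite /sig.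
have -> : vpath a b (inord 0) = map inord (iota 0 (a + 1).+1).
  rewrite /vpath /varm a0 /=; congr (_ :: _); by apply: val_inj; rewrite /= inordK.
rewrite val_path_perm_iota; last by apply: theta_le; lia.
decide_ifs.
Qed.

Lemma val_sig1 v : sig a b (inord 1) v =
  (if v == 0 :> nat then (if b == 0 then a + 1 else 2 * a + 2) else
   if v == a + 1 :> nat then 0 else if v < 2 * a + 2 then v : nat else
   if v == 2 * a + b + 1 :> nat then a + 1 else v.+1) :> nat.
Proof.
have lt_v : v < (2 * a + b + 1).+1 := ltn_ord v.
have [_ a1 _] := armE a b; rewrite /sig /vpath /varm a1.
case: (posnP b) => b0.
  have -> : iota (2 * a + 2) b = [::] by rewrite b0.
  rewrite /= pcompE perm1 val_tperm /swap_nat inordK; last by apply: theta_lt; lia.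
  by rewrite /=; decide_ifs.
pose u : vertex a b := inord (2 * a + b + 1).
have -> : ord0 :: map inord (rcons (iota (2 * a + 2) b) (a + 1)) =
   rcons (rcons (ord0 :: map inord (iota (2 * a + 2) b.-1)) u) (inord (a + 1)).
  have -> : iota (2 * a + 2) b = rcons (iota (2 * a + 2) b.-1) (2 * a + b + 1).
    by rewrite -{1}(prednK b0) -rcons_iota; congr (rcons _ _); lia.
  by rewrite !map_rcons.
rewrite path_perm_rcons.
have -> : rcons (ord0 :: map inord (iota (2 * a + 2) b.-1)) u =
   [:: ord0, inord (2 * a + 2) & map inord (iota (2 * a + 3) b.-1)].
  rewrite /u (_ : 2 * a + b + 1 = 2 * a + 2 + b.-1); last by lia.
  by rewrite rcons_cons -map_rcons rcons_iota /= !addnS.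
rewrite path_perm2 !pcompE val_tperm.
have -> : inord (2 * a + 2) :: map inord (iota (2 * a + 3) b.-1) =
   map inord (iota (2 * a + 2) b.-1.+1) :> seq (vertex a b) by rewrite /= !addnS.
rewrite val_path_perm_iota; last by apply: theta_le; lia.
rewrite val_tperm /u !inordK; try by apply: theta_lt; lia.
rewrite /swap_nat /=; decide_ifs.
Qed.

Lemma val_sig2 v : sig a b (inord 2) v =
  (if v == 0 :> nat then 2 * a + 1 else if v <= a then v : nat else
   if v == a + 1 :> nat then 0 else if v <= 2 * a + 1 then v.-1 else v) :> nat.
Proof.
have lt_v : v < (2 * a + b + 1).+1 := ltn_ord v.
have [_ _ a2] := armE a b; rewrite /sig /vpath /varm a2.
have -> : rev (iota (a + 1) (a + 1)) = 2 * a + 1 :: rev (iota (a + 1) a).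
  have -> : iota (a + 1) (a + 1) = rcons (iota (a + 1) a) (2 * a + 1).
    by rewrite [X in iota _ X]addn1 -rcons_iota; congr (rcons _ _); lia.
  by rewrite rev_rcons.
rewrite map_cons path_perm2 -map_cons.
have -> : 2 * a + 1 :: rev (iota (a + 1) a) = rev (iota (a + 1) a.+1).
  by rewrite -rcons_iota rev_rcons; congr (_ :: _); lia.
rewrite map_rev path_perm_rev pcompE val_tperm inordK; last by apply: theta_lt; lia.
set p := path_perm _; have := permKV p v; move: (p^-1 v)%g => t ptv.
have : p t = v :> nat by rewrite ptv.
rewrite val_path_perm_iota /swap_nat /=; last by apply: theta_le; lia.
have := ltn_ord t; have t0 : t = t :> nat by [].
by case: ifP => ?; [|case: ifP => ?] => _ E; decide_ifs.
Qed.

Lemma sig_inj : 0 < a -> injective (sig a b).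
Proof.
move=> ha; suff sig0 k l : sig a b k ord0 = sig a b l ord0 -> k = l.
  by move=> k l kl; apply: sig0; rewrite kl.
move/(congr1 val) => /=; move: k l; apply: ord3P; apply: ord3P;
by rewrite ?val_sig0 ?val_sig1 ?val_sig2 //=; (try case: (b =P 0)) => *; exfalso; lia.
Qed.

Definition loop (k l : 'I_3) : 'S_(order_theta a b) :=
  restr0 (pcomp (sig a b k) (sig a b l)^-1)%g.

(** The puzzle group at v_0: the permutations of the tokens obtained by
    bringing the blank back to v_0. *)
Definition loop_group := <<[set loop kl.1 kl.2 | kl : 'I_3 * 'I_3]>>%G.

Lemma loop_in k l : loop k l \in loop_group.
Proof. by apply: mem_gen; apply/imsetP; exists (k, l). Qed.

Lemma extend0_loop k l : extend0 (loop k l) = pcomp (sig a b k) (sig a b l)^-1%g.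
Proof.
rewrite restr0K // pcompE.
have -> : (sig a b l)^-1%g ord0 = hub a b by rewrite -(sig_hub a b l) permK.
exact: sig_hub.
Qed.

(** The values of [loop k l] are read off those of the two path permutations,
    without inverting either. *)
Lemma val_loop k l (i : 'I_(order_theta a b)) : exists u : vertex a b,
  sig a b l u = i.+1 :> nat /\ sig a b k u = (loop k l i).+1 :> nat.
Proof.
exists ((sig a b l)^-1 (lift ord0 i))%g; rewrite permKV lift0; split=> //.
by rewrite -pcompE -extend0_loop lift_perm_lift lift0.
Qed.

Lemma Alt_sub_loop : 0 < a -> (a, b) <> (2, 1) ->
  ('Alt_('I_(order_theta a b)))%g \subset loop_group.
Proof.
move=> ha hab.
apply: (@Alt_sub_theta a b _ loop_group (loop (inord 0) (inord 2))
   (loop (inord 0) (inord 1)) (loop (inord 2) (inord 1))) => //; try exact: loop_in.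
- move=> i; have [u []] := val_loop (inord 0) (inord 2) i.
  rewrite val_sig2 val_sig0 /loop13; have := ltn_ord i; have := ltn_ord u.
  by move: (nat_of_ord u) => u'; decide_ifs.
- move=> i; have [u []] := val_loop (inord 0) (inord 1) i.
  rewrite val_sig1 val_sig0 /loop12; have := ltn_ord i; have := ltn_ord u.
  by move: (nat_of_ord u) => u'; decide_ifs.
- move=> i; have [u []] := val_loop (inord 2) (inord 1) i.
  rewrite val_sig1 val_sig2 /loop32; have := ltn_ord i; have := ltn_ord u.
  by move: (nat_of_ord u) => u'; decide_ifs.
Qed.

End Values.

(** * Parity and symmetry *)

(** An involution is the product of the transpositions (i (s i)), i < s i. *)
Lemma odd_involution N (s : 'S_N) : (s * s)%g = 1%g ->
  odd_perm s = odd #|[set i : 'I_N | i < s i]|.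
Proof.
have [m] := ubnP #|[set i : 'I_N | i < s i]|; elim: m s => // m IHm s lt_m ss.
have sK : involutive s by move=> i; rewrite -permM ss perm1.
have [s0|[i]] := set_0Vmem [set i : 'I_N | i < s i].
  rewrite s0 cards0 (_ : s = 1%g) ?odd_perm1 //; apply/permP=> j; rewrite perm1.
  have le t : s t <= t by have := in_set0 t; rewrite -s0 inE; lia.
  by apply: val_inj => /=; have := le j; have := le (s j); rewrite sK; lia.
rewrite inE => lt_i; pose s' := (tperm i (s i) * s)%g.
have i_si : i != s i by rewrite -val_eqE /=; lia.
have s'E j : s' j = if (j == i) || (j == s i) then j else s j.
  rewrite permM; case: tpermP => [->|->|/eqP/negbTE-> /eqP/negbTE->] //.
    by rewrite eqxx sK.
  by rewrite eqxx orbT.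
have setE : [set j : 'I_N | j < s' j] = [set j : 'I_N | j < s j] :\ i.
  apply/setP=> j; rewrite !inE s'E; have [->|ji] := eqVneq j i; first by rewrite ltnn.
  by have [->|//] := eqVneq j (s i); rewrite sK ltnn /=; lia.
have cardE : #|[set j : 'I_N | j < s j]| = #|[set j : 'I_N | j < s' j]|.+1.
  by rewrite setE [LHS](cardsD1 i) inE lt_i.
have s'K : (s' * s')%g = 1%g.
  apply/permP=> j; rewrite permM perm1 (s'E j).
  have [->|ji] := eqVneq j i; first by rewrite s'E eqxx.
  have [->|js] := eqVneq j (s i); first by rewrite s'E eqxx orbT.
  by rewrite s'E (inj_eq perm_inj) (negbTE ji) -{1}[i]sK (inj_eq perm_inj) (negbTE js) sK.
have := IHm s'; rewrite cardE /s' odd_mul_tperm i_si /= => <- //.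
  by rewrite negbK.
by move: lt_m; rewrite cardE.
Qed.

Lemma map_rev_iota c m l : c + 1 = m + m + l ->
  [seq c - i | i <- iota m l] = rev (iota m l).
Proof.
move=> cE; apply: (@eq_from_nth _ 0); rewrite size_map ?size_rev // => i.
rewrite size_iota => lt_i; rewrite (nth_map 0) ?size_iota // nth_rev size_iota //.
by rewrite !nth_iota //; lia.
Qed.

Lemma map_arm a b (f : nat -> nat) k l : f 0 = a + 1 -> f (a + 1) = 0 ->
  map f (inner a b k) = rev (inner a b l) ->
  map f (0 :: arm a b k) = rev (0 :: arm a b l).
Proof.
by move=> f0 fa fk; rewrite /arm /= map_rcons f0 fa fk rev_cons rev_rcons.
Qed.

(** Conjugating the cycle of a path by phi gives the cycle of its image, and
    reversing a path inverts its cycle. *)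
Lemma conj_sig a b (phi : {perm vertex a b}) (f : nat -> nat) k l :
  (phi * phi)%g = 1%g -> (forall v, phi v = f v :> nat) ->
  map f (0 :: arm a b k) = rev (0 :: arm a b l) ->
  pcomp phi (pcomp (sig a b k) phi) = (sig a b l)^-1%g.
Proof.
move=> phiK phiE fkl.
have phiV : (phi^-1 = phi)%g by apply/eqP; rewrite eq_invg_mul phiK.
have -> : pcomp phi (pcomp (sig a b k) phi) = (sig a b k ^ phi)%g.
  by rewrite /pcomp conjgE phiV mulgA.
rewrite /sig -path_perm_map -path_perm_rev; congr path_perm.
apply: (inj_map val_inj); rewrite map_rev map_val_vpath -fkl -map_val_vpath.
by rewrite -!map_comp; apply: eq_map => v /=.
Qed.

Section Involutions.
Variables (a b : nat).

Lemma rhoK : (rho a b * rho a b)%g = 1%g.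
Proof. by apply/permP=> v; rewrite permM !permE rho_funK. Qed.

Lemma psiK : (psi a b * psi a b)%g = 1%g.
Proof. by apply/permP=> v; rewrite permM !permE psi_funK. Qed.

Lemma rho0 : rho a b ord0 = hub a b.
Proof. by apply: val_inj; rewrite permE [LHS]val_rho_fun [RHS]val_hub. Qed.

Lemma psi0 : psi a b ord0 = hub a b.
Proof. by apply: val_inj; rewrite permE [LHS]val_psi_fun [RHS]val_hub /= subn0. Qed.

(** Half a turn of the outer cycle maps p_1 to the reverse of p_3. *)
Definition flip_outer (k : 'I_3) : 'I_3 := inord (2 - k).

Lemma flip_outerK : involutive flip_outer.
Proof. by move=> k; apply: val_inj; have := ltn_ord k; rewrite /= !inordK; lia. Qed.

Lemma conj_sig_rho k :
  pcomp (rho a b) (pcomp (sig a b k) (rho a b)) = (sig a b (flip_outer k))^-1%g.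
Proof.
pose f v := if v <= a then v + a + 1
  else if v <= 2 * a + 1 then v - (a + 1) else 4 * a + b + 3 - v.
apply: (@conj_sig a b _ f _ _ rhoK) => [v|]; first by rewrite permE [LHS]val_rho_fun.
apply: map_arm; rewrite /f; try by decide_ifs.
move: k; apply: ord3P; rewrite /inner /flip_outer !inordK //= ?inordK //=.
- rewrite revK (_ : a + 2 = a.+1 + 1) ?iotaDl; last by lia.
  apply/eq_in_map => i; rewrite mem_iota; decide_ifs.
- rewrite -(@map_rev_iota (4 * a + b + 3)); last by lia.
  apply/eq_in_map => i; rewrite mem_iota; decide_ifs.
- rewrite map_rev; congr rev; rewrite (_ : a + 2 = a.+1 + 1) ?iotaDl -?map_comp; last by lia.
  rewrite -[RHS]map_id; apply/eq_in_map => i; rewrite mem_iota /=; decide_ifs.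
Qed.

Lemma conj_sig_psi k :
  pcomp (psi a b) (pcomp (sig a b k) (psi a b)) = (sig a b k)^-1%g.
Proof.
pose f v := if v <= a + 1 then a + 1 - v
  else if v <= 2 * a + 1 then 3 * a + 3 - v else 4 * a + b + 3 - v.
apply: (@conj_sig a b _ f _ _ psiK) => [v|]; first by rewrite permE [LHS]val_psi_fun.
apply: map_arm; rewrite /f; try by decide_ifs.
move: k; apply: ord3P; rewrite /inner !inordK //=.
- rewrite -(@map_rev_iota (a + 1)); last by lia.
  apply/eq_in_map => i; rewrite mem_iota; decide_ifs.
- rewrite -(@map_rev_iota (4 * a + b + 3)); last by lia.
  apply/eq_in_map => i; rewrite mem_iota; decide_ifs.
- rewrite map_rev -(@map_rev_iota (3 * a + 3)); last by lia.
  congr rev; apply/eq_in_map => i; rewrite mem_iota; decide_ifs.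
Qed.

Lemma sum_interval m l N : m + l <= N ->
  \sum_(i < N) ((m <= i) && (i < m + l) : nat) = l.
Proof.
elim: l => [|l IHl] mlN; first by rewrite big1 // => i _; lia.
have lt_ml : m + l < N by lia.
rewrite (eq_bigr (fun i : 'I_N => ((m <= i) && (i < m + l)) + (i == Ordinal lt_ml))).
  rewrite big_split /= IHl; last by lia.
  rewrite (bigD1 (Ordinal lt_ml)) //= eqxx big1 ?addn0 ?addn1 // => i /negbTE->.
  by [].
by move=> i _; rewrite -val_eqE /=; lia.
Qed.

(** The involution rho exchanges a + 1 pairs on the outer cycle and b./2 pairs
    on p_2. *)
Lemma odd_rho : rho a b = odd (a + 1 + b./2) :> bool.
Proof.
rewrite (odd_involution rhoK) cardsE -sum1_card big_mkcond /=; congr odd.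
transitivity (\sum_(i < (order_theta a b).+1) (((0 <= i) && (i < 0 + (a + 1)))
   + ((2 * a + 2 <= i) && (i < 2 * a + 2 + b./2)))).
  apply: eq_bigr => i _; rewrite [_ \in _]/= unfold_in /= permE val_rho_fun.
  have : i < (2 * a + b + 1).+1 := ltn_ord i.
  by move: (nat_of_ord i) => j; decide_ifs.
by rewrite big_split; congr (_ + _); apply: sum_interval; rewrite /order_theta; lia.
Qed.

(** The involution psi exchanges a./2 + 1 pairs on p_1, a./2 pairs inside p_3
    and b./2 pairs on p_2; the two a./2 cancel. *)
Lemma odd_psi : psi a b = odd (1 + b./2) :> bool.
Proof.
rewrite (odd_involution psiK) cardsE -sum1_card big_mkcond /=.
transitivity (odd (\sum_(i < (order_theta a b).+1) (((0 <= i) && (i < 0 + (a./2 + 1)))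
   + ((a + 2 <= i) && (i < a + 2 + a./2))
   + ((2 * a + 2 <= i) && (i < 2 * a + 2 + b./2))))).
  congr odd; apply: eq_bigr => i _; rewrite [_ \in _]/= unfold_in /= permE val_psi_fun.
  have : i < (2 * a + b + 1).+1 := ltn_ord i.
  by move: (nat_of_ord i) => j; decide_ifs.
transitivity (odd (a./2 + 1 + a./2 + b./2)); last by lia.
congr odd; rewrite !big_split; congr (_ + _ + _);
  apply: sum_interval; rewrite /order_theta; lia.
Qed.

Lemma odd_sig k : sig a b k = odd (size (arm a b k)) :> bool.
Proof. by rewrite /sig odd_path_perm ?vpath_uniq // size_map. Qed.

(** When a + b is even, the three paths have lengths of equal parity. *)
Lemma odd_sig_even k : ~~ odd (a + b) -> sig a b k = odd (a + 1) :> bool.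
Proof.
rewrite odd_sig /arm size_rcons /inner; move: k; apply: ord3P;
by rewrite inordK //= ?size_rev size_iota; lia.
Qed.

End Involutions.

(** * Generation, connectedness and the component of the initial position *)

Lemma Alt_odd_setT (T : finType) (G : {group {perm T}}) (s : {perm T}) :
  ('Alt_T)%g \subset G -> s \in G -> odd_perm s -> G = [set: {perm T}] :> {set _}.
Proof.
move=> altG sG odd_s; apply/setP=> t; rewrite inE.
have [odd_t|even_t] := boolP (odd_perm t); last by rewrite (subsetP altG) // Alt_even.
rewrite -(mulgKV s t) groupM // (subsetP altG) // Alt_even odd_permM odd_permV.
by rewrite odd_t odd_s.
Qed.

Section Reach.
Variables (a b : nat) (ha : 0 < a).
Local Notation n := (order_theta a b).
Implicit Types (f g : {perm vertex a b}).

(** Moving the blank along p_k and back along p_l realizes [loop k l], so every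
    element of the puzzle group can be realized from any position with blank at
    v_0. The relation e is left open in order to serve both the puzzle graph
    and its contraction. *)
Lemma connect_loop (e : rel {perm vertex a b}) s :
  (forall f k, blank f = ord0 ->
     connect e f (pcomp f (sig a b k)) && connect e (pcomp f (sig a b k)) f) ->
  s \in loop_group a b ->
  forall f, blank f = ord0 -> connect e f (pcomp f (extend0 s)).
Proof.
move=> eE.
have gP : group_set [set s : 'S_n |
    [forall f, (blank f == ord0) ==> connect e f (pcomp f (extend0 s))]].
  apply/group_setP; split=> [|t u].
    rewrite inE; apply/forallP=> f; apply/implyP=> _.
    by rewrite /extend0 lift_perm1 /pcomp mul1g.
  rewrite !inE => /forallP tP /forallP uP; apply/forallP=> f; apply/implyP=> f0.
  have uf := implyP (uP f) f0; apply: connect_trans uf _.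
  have -> : pcomp f (extend0 (t * u)%g) = pcomp (pcomp f (extend0 u)) (extend0 t).
    by rewrite -[(t * u)%g]/(pcomp u t) extend0M /pcomp mulgA.
  apply: (implyP (tP _)); apply/eqP/blank_of; rewrite pcompE extend0_0.
  exact/at_blank/eqP.
suff sub : loop_group a b \subset Group gP.
  by move/(subsetP sub); rewrite inE => /forallP sP f f0; apply: (implyP (sP f)); apply/eqP.
rewrite gen_subG; apply/subsetP=> _ /imsetP[[k l] _ ->]; rewrite inE.
apply/forallP=> f; apply/implyP=> /eqP f0; rewrite extend0_loop /=.
set h := pcomp f (pcomp _ _).
have h0 : blank h = ord0.
  by apply: blank_of; rewrite /h -extend0_loop pcompE extend0_0; apply: at_blank.
have hf : pcomp h (sig a b l) = pcomp f (sig a b k).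
  by rewrite /h /pcomp !mulgA mulgV mul1g.
have /andP[fk _] := eE f k f0; apply: connect_trans fk _; rewrite -hf.
by have /andP[] := eE h l h0.
Qed.

Section Gens.
Variable phi : {perm vertex a b}.
Hypothesis phi0 : phi ord0 = hub a b.

(** A product sigma_k phi (sigma_l phi)^-1 no longer involves phi. *)
Lemma loop_sub_gens : loop_group a b \subset <<gens phi>>%G.
Proof.
rewrite gen_subG; apply/subsetP=> _ /imsetP[[k l] _ ->] /=.
pose g k := restr0 (pcomp (sig a b k) phi).
have gG j : g j \in <<gens phi>>%g by rewrite mem_gen ?sig_gens.
have -> : loop a b k l = ((g l)^-1 * g k)%g.
  apply: (mulgI (g l)); rewrite mulKVg; apply: extend0_inj.
  rewrite -[(_ * loop a b k l)%g]/(pcomp (loop a b k l) (g l)) extend0M extend0_loop.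
  rewrite !restr0K ?pcompE ?phi0 ?sig_hub //.
  by rewrite /pcomp !mulgA mulgK.
by rewrite groupM ?groupV.
Qed.

Lemma odd_gens s : s \in gens phi -> exists k, odd_perm s = sig a b k (+) phi.
Proof.
case/imsetP=> k _ ->; exists k; rewrite odd_restr0 ?pcompE ?phi0 ?sig_hub //.
by rewrite /pcomp odd_permM addbC.
Qed.

End Gens.

Lemma loop_setT : (a, b) <> (2, 1) -> odd (a + b) -> loop_group a b = [set: 'S_n] :> {set _}.
Proof.
move=> hab ab; apply: (@Alt_odd_setT _ _ (loop a b (inord 0) (inord 1))).
- exact: Alt_sub_loop.
- exact: loop_in.
rewrite -odd_extend0 extend0_loop /pcomp odd_permM odd_permV !odd_sig.
by have [-> -> _] := armE a b; rewrite size_rcons !size_iota; lia.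
Qed.

Lemma gens_setT (phi : {perm vertex a b}) : phi ord0 = hub a b -> (a, b) <> (2, 1) -> odd (a + b) ->
  <<gens phi>>%g = [set: 'S_n].
Proof.
move=> phi0 hab ab; apply/eqP; rewrite eqEsubset subsetT -(loop_setT hab ab).
exact: loop_sub_gens.
Qed.

Lemma gens_parity (phi : {perm vertex a b}) : phi ord0 = hub a b -> (a, b) <> (2, 1) -> ~~ odd (a + b) ->
  <<gens phi>>%g = if odd (a + 1) (+) phi then [set: 'S_n] else ('Alt_('I_n))%g.
Proof.
move=> phi0 hab ab; have sub := subset_trans (Alt_sub_loop ha hab) (loop_sub_gens phi0).
have odd_s s : s \in gens phi -> odd_perm s = odd (a + 1) (+) phi.
  by case/(odd_gens phi0)=> k ->; rewrite odd_sig_even.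
case: ifP => e.
  apply: (Alt_odd_setT sub (mem_gen (sig_gens phi ord0))).
  by rewrite odd_s ?sig_gens.
apply/eqP; rewrite eqEsubset sub andbT gen_subG.
by apply/subsetP=> s /odd_s; rewrite Alt_even e => ->.
Qed.

Lemma end_arcs_sig f k : blank f = ord0 ->
  0 < end_arcs f (pcomp f (sig a b k)) /\ 0 < end_arcs (pcomp f (sig a b k)) f.
Proof.
move=> f0; rewrite /end_arcs (bigD1 k) //= [in X in _ /\ X](bigD1 k) //=.
rewrite f0 !eqxx; split; lia.
Qed.

Lemma is_end_sig f k : blank f = ord0 -> is_end f /\ is_end (pcomp f (sig a b k)).
Proof. by move=> f0; rewrite /is_end blank_sig f0 !eqxx orbT. Qed.

Lemma strongly_connected_puz : (a, b) <> (2, 1) -> odd (a + b) ->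
  strongly_connected (path_contraction (puz a b)).
Proof.
move=> hab ab; set G := path_contraction _.
have closed f g : f \in [set: {perm vertex a b}] -> puz_adj f g -> g \in setT.
  by rewrite !inE.
have vE := vertsG ha closed; have aE := arcsG ha closed; rewrite -/G in vE aE.
have arcE f g : is_end f -> is_end g -> 0 < end_arcs f g -> arc_rel G f g.
  move=> Ef Eg fg; have [fG gG] : f \in verts G /\ g \in verts G.
    by rewrite vE !inE Ef Eg.
  by rewrite /arc_rel fG gG aE.
have eE f k : blank f = ord0 -> connect (arc_rel G) f (pcomp f (sig a b k)) &&
    connect (arc_rel G) (pcomp f (sig a b k)) f.
  move=> f0; have [Ef Ek] := is_end_sig k f0; have [fk kf] := end_arcs_sig k f0.
  by rewrite !connect1 ?arcE.
have to0 f : is_end f -> exists g,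
    [/\ blank g = ord0, connect (arc_rel G) f g & connect (arc_rel G) g f].
  case/is_endP=> [f0|fh]; first by exists f; rewrite !connect0.
  exists (pcomp f (sig a b ord0)^-1)%g; set g := pcomp f _.
  have gf : pcomp g (sig a b ord0) = f by rewrite /g /pcomp mulgA mulgV mul1g.
  have g0 : blank g = ord0 by apply/eqP; rewrite -(blank_sig g ord0) gf fh.
  by have := eE g ord0 g0; rewrite gf => /andP[].
move=> f g; rewrite vE !inE => Ef Eg.
have [f' [f0 ff _]] := to0 f Ef; have [g' [g0 _ gg]] := to0 g Eg.
apply: connect_trans ff (connect_trans _ gg).
have h0 : pcomp f'^-1%g g' ord0 = ord0.
  by rewrite pcompE (at_blank g0) -{1}(at_blank f0) permK.
have -> : g' = pcomp f' (extend0 (restr0 (pcomp f'^-1%g g'))).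
  by rewrite restr0K // /pcomp mulgKV.
by apply: (connect_loop eE) => //; rewrite (loop_setT hab ab) inE.
Qed.

(** A proper 2-colouring of the theta graph when a + b is even, with v_0
    coloured [false]. *)
Definition colour (v : vertex a b) : bool := odd (if v <= 2 * a + 1 then v : nat else v.+1).

Lemma theta_adj_colour v w : ~~ odd (a + b) -> theta_adj v w -> colour w = ~~ colour v.
Proof.
have edge u t : ~~ odd (a + b) -> theta_edge a b u t -> u < 2 * a + b + 2 ->
    t < 2 * a + b + 2 ->
    odd (if t <= 2 * a + 1 then t else t.+1) = ~~ odd (if u <= 2 * a + 1 then u else u.+1).
  by rewrite /theta_edge /order_theta => ab; case: (b =P 0) => b0;
    case: (leqP t (2 * a + 1)); case: (leqP u (2 * a + 1)); lia.
have lt (u : vertex a b) : u < 2 * a + b + 2 by rewrite [2 * a + b + 2]addnS ltn_ord.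
move=> ab /orP[] /(edge _ _ ab)-/(_ (lt _) (lt _)) cE; rewrite /colour cE //.
by rewrite negbK.
Qed.

Definition reach0 : {set {perm vertex a b}} :=
  [set f in [set: {perm vertex a b}] | connect (arc_rel (puz a b)) 1%g f].

Lemma arc_rel_puz f g : arc_rel (puz a b) f g = puz_adj f g.
Proof. by rewrite /arc_rel !inE lt0b. Qed.

Lemma reach0_closed f g : f \in reach0 -> puz_adj f g -> g \in reach0.
Proof.
rewrite !inE /= => f1 fg; apply: connect_trans f1 (connect1 _).
by rewrite arc_rel_puz.
Qed.

Lemma reach0_sig f k : blank f = ord0 -> (pcomp f (sig a b k) \in reach0) = (f \in reach0).
Proof. by move=> f0; apply: (sigW ha) => //; apply: reach0_closed. Qed.

(** Every slide composes the position with a transposition and changes the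
    colour of the blank. *)
Lemma odd_reach0 f : ~~ odd (a + b) -> f \in reach0 -> odd_perm f = colour (blank f).
Proof.
move=> ab; rewrite !inE /=.
pose P : {pred {perm vertex a b}} := fun f => odd_perm f == colour (blank f).
have closedP : closed (arc_rel (puz a b)) P.
  move=> g h; rewrite arc_rel_puz puz_adjE => /andP[gh /eqP hE].
  have bgh : blank g != blank h.
    by apply/eqP=> e; have := theta_adj_colour ab gh; rewrite e; case: colour.
  rewrite /P !unfold_in (theta_adj_colour ab gh) {1}hE /slide /pcomp odd_permM odd_tperm bgh.
  by case: odd_perm; case: colour.
move/(closed_connect closedP); rewrite /P !unfold_in odd_perm1.
have -> : blank (1%g : {perm vertex a b}) = ord0 by apply: blank_of; rewrite perm1.
by rewrite /colour /= => /esym/eqP.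
Qed.

Lemma reach0_even f : (a, b) <> (2, 1) -> blank f = ord0 -> ~~ odd_perm f -> f \in reach0.
Proof.
move=> hab f0 ev; rewrite !inE /=.
have b1 : blank (1%g : {perm vertex a b}) = ord0 by apply: blank_of; rewrite perm1.
have fE : pcomp 1%g (extend0 (restr0 f)) = f.
  by rewrite restr0K ?(at_blank f0) // /pcomp mulg1.
rewrite -fE; apply: connect_loop => //; last first.
  apply: (subsetP (Alt_sub_loop ha hab)).
  by rewrite Alt_even odd_restr0 // at_blank.
move=> g k g0.
have conn q u h : path (@theta_adj a b) u q -> blank h = u ->
    connect (arc_rel (puz a b)) h (pcomp h (path_perm (u :: q))) &&
    connect (arc_rel (puz a b)) (pcomp h (path_perm (u :: q))) h.
  elim: q u h => [|w q IHq] u h /=; first by rewrite /pcomp mul1g !connect0.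
  case/andP=> uw pq hu; have hw := blank_slide w hu.
  have := IHq w _ pq hw; rewrite {1 2}/slide /pcomp mulgA => /andP[c1 c2].
  have hs : puz_adj h (slide u w h) by apply: puz_adj_slide.
  apply/andP; split.
    by apply: connect_trans c1; apply: connect1; rewrite arc_rel_puz.
  by apply: connect_trans c2 _; apply: connect1; rewrite arc_rel_puz puz_adj_sym.
exact: conn (path_vpath b ha k) g0.
Qed.

(** Sign and colour agree on the component by [odd_reach0]; conversely all even
    positions with blank at v_0 are reached because the puzzle group contains
    the alternating group. *)
Lemma mem_reach0 f : (a, b) <> (2, 1) -> ~~ odd (a + b) -> is_end f ->
  (f \in reach0) = (odd_perm f == ((blank f == hub a b) && odd (a + 1))).
Proof.
move=> hab ab Ef; have cE : colour (blank f) = (blank f == hub a b) && odd (a + 1).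
  case/is_endP: Ef => ->; first by rewrite eq_sym (negbTE (hub_neq0 a b)).
  by rewrite eqxx /colour val_hub; case: ifP; lia.
apply/idP/eqP => [/(odd_reach0 ab)-> //|oddf].
case/is_endP: Ef oddf => [f0|fh].
  by rewrite f0 eq_sym (negbTE (hub_neq0 a b)) => /negbT; apply: reach0_even.
rewrite fh eqxx /=; set g := pcomp f (sig a b ord0)^-1%g.
have gf : pcomp g (sig a b ord0) = f by rewrite /g /pcomp mulgA mulgV mul1g.
have g0 : blank g = ord0 by apply/eqP; rewrite -(blank_sig g ord0) gf fh.
rewrite -gf reach0_sig // => oddf; apply: reach0_even => //.
move: oddf; rewrite /pcomp odd_permM odd_sig_even //.
by case: odd_perm; case: odd.
Qed.

Lemma odd_recentre (phi : {perm vertex a b}) f : phi ord0 = hub a b -> is_end f ->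
  odd_perm (recentre phi f).1 = odd_perm f (+) ((blank f == hub a b) && phi).
Proof.
move=> phi0 /is_endP[f0|fh].
  rewrite recentre0 //= odd_restr0 ?at_blank // f0 eq_sym (negbTE (hub_neq0 a b)).
  by rewrite addbF.
rewrite recentre1 //= odd_restr0 ?blank_phi // /pcomp odd_permM fh eqxx addbC.
by [].
Qed.

Section Isomorphisms.
Variables (phi : {perm vertex a b}) (pi : 'I_3 -> 'I_3).
Hypotheses (phiK : (phi * phi)%g = 1%g) (phi0 : phi ord0 = hub a b).
Hypotheses (piK : involutive pi)
  (phi_sig : forall k, pcomp phi (pcomp (sig a b k) phi) = (sig a b (pi k))^-1%g).
Hypotheses (hab : (a, b) <> (2, 1)).

Lemma iso_puz : digraph_iso (path_contraction (puz a b)) (CayY [set: 'S_n] (gens phi)).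
Proof.
apply: (iso_CayY ha phiK phi0 piK phi_sig (sig_inj ha)) => [f g|f _]; by rewrite !inE.
Qed.

(** The hypothesis on phi says that the generators sigma_k phi are even; the
    recentred positions of the component are then the even permutations. *)
Lemma iso_puz0_even : ~~ odd (a + b) -> odd (a + 1) = phi ->
  digraph_iso (path_contraction (puz0 a b)) (CayY ('Alt_('I_n))%g (gens phi)).
Proof.
move=> ab odd_phi.
apply: (iso_CayY ha phiK phi0 piK phi_sig (sig_inj ha) reach0_closed) => f Ef.
rewrite mem_reach0 // Alt_even odd_recentre // odd_phi.
by case: odd_perm; case: andb.
Qed.

(** With odd generators, the sign of a recentred position of the component tells
    where its blank was. *)
Lemma iso_puz0_odd : ~~ odd (a + b) -> odd (a + 1) = ~~ phi ->
  digraph_iso (path_contraction (puz0 a b)) (CayX [set: 'S_n] (gens phi)).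
Proof.
move=> ab odd_phi.
apply: (iso_CayX ha phiK phi0 piK phi_sig (sig_inj ha) reach0_closed) => [s|f Ef].
  by case/(odd_gens phi0)=> k ->; rewrite odd_sig_even // odd_phi; case: odd_perm.
rewrite mem_reach0 // odd_recentre // odd_phi.
case/is_endP: Ef => [f0|fh].
  have hub0 : (ord0 == hub a b) = false by rewrite eq_sym (negbTE (hub_neq0 a b)).
  by rewrite recentre0 //= f0 hub0 addbF; case: odd_perm.
by rewrite recentre1 //= fh !eqxx; case: odd_perm; case: odd_perm.
Qed.

End Isomorphisms.
End Reach.

Lemma genS1E a b : genS1 a b = gens (rho a b).
Proof.
have [e1 e2 e3] := vpathE a b.
apply/setP=> s; rewrite !inE /sigma_gen e1 e2 e3 -!/(sig a b _).
apply/idP/imsetP => [|[k _ ->]].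
  by rewrite -orbA => /or3P[]/eqP->; [exists (inord 0)|exists (inord 1)|exists (inord 2)].
by move: k; apply: ord3P; rewrite eqxx ?orbT.
Qed.

Lemma genS2E a b : genS2 a b = gens (psi a b).
Proof.
have [e1 e2 e3] := vpathE a b.
apply/setP=> s; rewrite !inE /tau_gen e1 e2 e3 -!/(sig a b _).
apply/idP/imsetP => [|[k _ ->]].
  by rewrite -orbA => /or3P[]/eqP->; [exists (inord 0)|exists (inord 1)|exists (inord 2)].
by move: k; apply: ord3P; rewrite eqxx ?orbT.
Qed.

Theorem theorem2 (a b : nat) (ha : 0 < a) (hab : (a, b) <> (2, 1)) :
  let n := order_theta a b in
  let Sn : {set 'S_n} := [set: 'S_n] in
  let An : {set 'S_n} := ('Alt_('I_n))%g in
  let tpuz := path_contraction (puz a b) in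
  let tpuz0 := path_contraction (puz0 a b) in
  [/\ digraph_iso tpuz (CayY Sn (genS1 a b))
    & digraph_iso (CayY Sn (genS1 a b)) (CayY Sn (genS2 a b))]
  /\ [/\ (odd (a + b) ->
            [/\ generates (genS1 a b) Sn, generates (genS2 a b) Sn
              & strongly_connected tpuz]),
         (a = 0 %[mod 2] -> b = 0 %[mod 4] ->
            [/\ digraph_iso tpuz0 (CayY An (genS1 a b)),
                digraph_iso (CayY An (genS1 a b)) (CayY An (genS2 a b)),
                generates (genS1 a b) An & generates (genS2 a b) An]),
         (a = 0 %[mod 2] -> b = 2 %[mod 4] ->
            [/\ digraph_iso tpuz0 (CayX Sn (genS1 a b)),
                digraph_iso (CayX Sn (genS1 a b)) (CayX Sn (genS2 a b)),
                generates (genS1 a b) Sn & generates (genS2 a b) Sn]),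
         (a = 1 %[mod 2] -> b = 1 %[mod 4] ->
            [/\ digraph_iso tpuz0 (CayY An (genS1 a b)),
                digraph_iso (CayY An (genS1 a b)) (CayX Sn (genS2 a b)),
                generates (genS1 a b) An & generates (genS2 a b) Sn])
       & (a = 1 %[mod 2] -> b = 3 %[mod 4] ->
            [/\ digraph_iso tpuz0 (CayX Sn (genS1 a b)),
                digraph_iso (CayX Sn (genS1 a b)) (CayY An (genS2 a b)),
                generates (genS1 a b) Sn & generates (genS2 a b) An])].
Proof.
move=> n Sn An tpuz tpuz0; rewrite genS1E genS2E.
have via (T U V : finType) (G : digraph T) (H : digraph U) (K : digraph V) (x0 : T) :
    digraph_iso G H -> digraph_iso G K -> digraph_iso H K.
  by move=> GH; apply: digraph_iso_trans; apply: digraph_iso_sym x0 GH.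
have r0 := rho0 a b; have p0 := psi0 a b.
have r_sig := @conj_sig_rho a b; have p_sig := @conj_sig_psi a b.
have rI := iso_puz ha (rhoK a b) r0 flip_outerK r_sig.
have pI := iso_puz ha (psiK a b) p0 (pi := id) (fun=> erefl) p_sig.
have rE := iso_puz0_even ha (rhoK a b) r0 flip_outerK r_sig hab.
have pE := iso_puz0_even ha (psiK a b) p0 (pi := id) (fun=> erefl) p_sig hab.
have rO := iso_puz0_odd ha (rhoK a b) r0 flip_outerK r_sig hab.
have pO := iso_puz0_odd ha (psiK a b) p0 (pi := id) (fun=> erefl) p_sig hab.
have rG := gens_parity ha r0 hab; have pG := gens_parity ha p0 hab.
rewrite odd_rho in rE rO rG; rewrite odd_psi in pE pO pG.
have x0 : {perm vertex a b} := 1%g.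
split; first by split=> //; apply: via x0 rI pI.
split.
- move=> ab; split; try by apply: gens_setT.
  exact: strongly_connected_puz.
- move=> a2 b4; have ab : ~~ odd (a + b) by lia.
  have {rE}rI0 := rE ab ltac:(lia); have {pE}pI0 := pE ab ltac:(lia).
  split=> //; first exact: via x0 rI0 pI0.
    by rewrite /generates rG //; case: ifP => //; lia.
  by rewrite /generates pG //; case: ifP => //; lia.
- move=> a2 b4; have ab : ~~ odd (a + b) by lia.
  have {rO}rI0 := rO ab ltac:(lia); have {pO}pI0 := pO ab ltac:(lia).
  split=> //; first exact: via x0 rI0 pI0.
    by rewrite /generates rG //; case: ifP => //; lia.
  by rewrite /generates pG //; case: ifP => //; lia.
- move=> a2 b4; have ab : ~~ odd (a + b) by lia.
  have {rE}rI0 := rE ab ltac:(lia); have {pO}pI0 := pO ab ltac:(lia).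
  split=> //; first exact: via x0 rI0 pI0.
    by rewrite /generates rG //; case: ifP => //; lia.
  by rewrite /generates pG //; case: ifP => //; lia.
- move=> a2 b4; have ab : ~~ odd (a + b) by lia.
  have {rO}rI0 := rO ab ltac:(lia); have {pE}pI0 := pE ab ltac:(lia).
  split=> //; first exact: via x0 rI0 pI0.
    by rewrite /generates rG //; case: ifP => //; lia.
  by rewrite /generates pG //; case: ifP => //; lia.
Qed.
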